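(* Let $\mathcal{X}$ be a finite-dimensional real vector space, $\mathcal{C}\subset\mathcal{X}$ a closed pointed convex cone with nonempty interior $\mathcal{C}^0$, and $\mathbf{e}\in\mathcal{C}^0$. Let $\phi:\mathcal{X}\to\mathcal{X}$ be continuously differentiable and satisfy $\phi(x+\lambda\mathbf{e})=\phi(x)$ for all $\lambda\in\mathbb{R}$, $x\in\mathcal{X}$. Let $U\subset\mathcal{X}$ be a convex open set. Then the contraction rate $\alpha(U)$, with respect to Hopf's oscillation seminorm, of the flow of $\dot x=\phi(x)$ restricted to $U$ is given by $$\alpha(U)=\sup_{x\in U}h(D\phi(x)).$$
   Context: Order: $x\le y$ iff $y-x\in\mathcal{C}$; $[0,\mathbf{e}]=\{x:0\le x\le\mathbf{e}\}$. Hopf's oscillation seminorm: $\|x\|_H=\omega(x/\mathbf{e})=\inf\{t\in\mathbb{R}:x\le t\mathbf{e}\}-\sup\{t\in\mathbb{R}:x\ge t\mathbf{e}\}$. Dual cone $\mathcal{C}^\star=\{\mu\in\mathcal{X}^\star:\langle\mu,x\rangle\ge0\ \forall x\in\mathcal{C}\}$, simplex $\mathcal{P}(\mathbf{e})=\{\mu\in\mathcal{C}^\star:\langle\mu,\mathbf{e}\rangle=1\}$; $\operatorname{extr}$ denotes extreme points. For $x_0\in\mathcal{X}$, $t\mapsto M_t(x_0)$ denotes the unique maximal solution of $\dot x=\phi(x)$, $x(0)=x_0$, defined on the maximal interval $J(x_0)$. For $x_0\in U$, $t_U(x_0)=\sup\{t_0\in J(x_0): t_0\ge 0,\ M_t(x_0)\in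 U\ \forall t\in[0,t_0)\}$. The contraction rate is $$\alpha(U)=\inf\{\beta\in\mathbb{R}:\ \|M_t(x)-M_t(y)\|_H\le e^{\beta t}\|x-y\|_H\ \text{ for all } x,y\in U,\ 0\le t<\min(t_U(x),t_U(y))\}.$$ For a linear map $L:\mathcal{X}\to\mathcal{X}$ with $L(\mathbf{e})=0$, $$h(L)=-\inf_{\nu,\pi\in\operatorname{extr}\mathcal{P}(\mathbf{e})}\ \inf_{\substack{x\in\operatorname{extr}([0,\mathbf{e}])\\ \langle\nu,x\rangle+\langle\pi,\mathbf{e}-x\rangle=0}}\big(\langle\nu,L(x)\rangle+\langle\pi,L(\mathbf{e}-x)\rangle\big).$$ Infima and suprema are taken in $[-\infty,+\infty]$, with $\inf\emptyset=+\infty$, $\sup\emptyset=-\infty$. (Note $D\phi(x)\mathbf{e}=0$ by the invariance of $\phi$.) *)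

(* Defs.v *)
From HB Require Import structures.
From mathcomp Require Import all_boot all_order all_algebra.
From mathcomp Require Import all_classical all_reals all_analysis.

Set Implicit Arguments.
Unset Strict Implicit.
Unset Printing Implicit Defensive.

Import Order.TTheory GRing.Theory Num.Theory.
Import numFieldNormedType.Exports.

Local Open Scope classical_set_scope.
Local Open Scope ring_scope.

(* A finite-dimensional real vector space carries a unique Hausdorff vector
   topology, and every norm induces it. The norm of the structure below serves
   only to name that topology. *)
#[short(type="finDimNormedModType")]
HB.structure Definition FinDimNormedModule (K : numFieldType) :=
  {T of NormedModule K T & Vector K T}.

Section Convexity.
Context {R : realType}.

Definition extreme_points (V : lmodType R) (A : set V) : set V :=
  [set x | A x /\ forall (y z : V) (t : R), A y -> A z -> 0 < t < 1 ->
             x = t *: y + (1 - t) *: z -> y = x /\ z = x].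

Definition convex_cone (V : lmodType R) (C : set V) : Prop :=
  (forall x y, C x -> C y -> C (x + y)) /\
  (forall (a : R) x, 0 <= a -> C x -> C (a *: x)).

Definition pointed_cone (V : lmodType R) (C : set V) : Prop :=
  C `&` [set x | C (- x)] = [set 0].

End Convexity.

Section HopfSeminorm.
Context {R : realType} {X : finDimNormedModType R}.
Variables (C : set X) (e : X).

Definition cone_le (x y : X) : Prop := C (y - x).

Definition order_interval (a b : X) : set X :=
  [set x | cone_le a x /\ cone_le x b].

(* Finite whenever X is nonzero, and equal to -oo when X = {0}. *)
Definition hopf_seminorm (x : X) : \bar R :=
  (ereal_inf [set t%:E | t in [set t : R | cone_le x (t *: e)]]
   - ereal_sup [set t%:E | t in [set t : R | cone_le (t *: e) x]])%E.

Definition dual_cone : set 'Hom(X, R^o) :=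
  [set mu | forall x, C x -> (0 : R) <= mu x].

Definition simplex : set 'Hom(X, R^o) :=
  [set mu | dual_cone mu /\ mu e = 1].

Definition hopf_h (L : {linear X -> X}) : \bar R :=
  (- ereal_inf [set
       ereal_inf [set (nu (L x) + pi (L (e - x)))%R%:E | x in
         [set x | extreme_points (order_interval 0%R e) x /\
                  (nu x + pi (e - x) = 0)%R]]
     | nu in extreme_points simplex & pi in extreme_points simplex])%E.

End HopfSeminorm.

Section Flow.
Context {R : realType} {X : finDimNormedModType R}.
Variable phi : X -> X.

(* Continuity of the derivative is with respect to the operator norm. *)
Definition continuously_differentiable : Prop :=
  (forall x, differentiable phi x) /\
  (forall (x : X) (eps : R), 0 < eps ->
     \forall y \near x, forall v, `|'d phi y v - 'd phi x v| <= eps * `|v|).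

(* The values of u outside J are irrelevant. *)
Definition is_solution (x0 : X) (J : set R) (u : R -> X) : Prop :=
  [/\ open J, is_interval J, J 0, u 0 = x0 &
      forall t : R, J t -> is_derive t (1 : R) u (phi (u t))].

Definition is_maximal_solution (x0 : X) (J : set R) (u : R -> X) : Prop :=
  is_solution x0 J u /\
  forall (J' : set R) (v : R -> X), is_solution x0 J' v -> J `<=` J' ->
    (forall t, J t -> v t = u t) -> J' = J.

(* When phi is continuously differentiable, the Cauchy-Lipschitz theorem
   provides a maximal solution, unique up to the values of u outside J. *)
Definition maximal_solution (x0 : X) : set R * (R -> X) :=
  get [set Ju | is_maximal_solution x0 Ju.1 Ju.2].

Definition flow_domain (x0 : X) : set R := (maximal_solution x0).1.

Definition flow (t : R) (x0 : X) : X := (maximal_solution x0).2 t.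

Definition exit_time (U : set X) (x0 : X) : \bar R :=
  ereal_sup [set t0%:E | t0 in
    [set t0 : R | [/\ flow_domain x0 t0, 0 <= t0 &
                      forall t, 0 <= t -> t < t0 -> U (flow t x0)]]].

Definition contraction_rate (C : set X) (e : X) (U : set X) : \bar R :=
  ereal_inf [set beta%:E | beta in
    [set beta : R | forall (x y : X) (t : R), U x -> U y -> 0 <= t ->
       (t%:E < Order.min (exit_time U x) (exit_time U y))%E ->
       (hopf_seminorm C e (flow t x - flow t y)%R
          <= (expR (beta * t))%:E * hopf_seminorm C e (x - y)%R)%E]].

End Flow.

(* Main.v *)
From HB Require Import structures.
Require Import Defs.
From mathcomp Require Import all_boot all_order all_algebra.
From mathcomp Require Import all_classical all_reals all_analysis.
From mathcomp Require Import ring lra.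
Set Implicit Arguments.
Unset Strict Implicit.
Unset Printing Implicit Defensive.
Import Order.TTheory GRing.Theory Num.Theory.
Import numFieldNormedType.Exports.
Import VectorInternalTheory.
Local Open Scope classical_set_scope.
Local Open Scope ring_scope.

(** Let P be the simplex of positive functionals normalized at e. Hopf's
    seminorm has the dual description

      |z|_H = max of pi z - nu z over pi, nu in P       (hopf_attained),

    because z <= t e holds if and only if pi z <= t for all pi in P
    (simplex_separation), and P is compact. So along two solutions x, y of the
    ODE, with z = x - y, the seminorm is a maximum of differentiable
    functions (pi - nu) (z t), whose derivatives (pi - nu) (phi x - phi y) equal, by the
    mean value theorem on the segment from y to x, (pi - nu) (L z) for
    L = Dphi(w) at some w in U (U is convex).

    What the flow contracts is therefore measured by the largest value of
    (pi - nu) (L z) over pi, nu that attain |z|_H = 1. As L e = 0, z may be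
    translated along e into the order interval [0, e], where the attaining
    pairs are those with nu z = 0 and pi z = 1. For two of the three
    arguments pi, nu, z fixed, the remaining one ranges over a face of a
    compact convex set, on which an affine function is maximal at an extreme
    point of the whole set (extreme_maximizer). Hence the maximum is h(L), the
    same supremum taken over extreme points only (hopf_h_maximizer).

    Both inequalities follow. If h(Dphi(w)) <= b on U and eps > 0, consider
    s |-> e^(-bs) |z s|_H - eps s on [0, T]. At a maximum point c > 0, replacing
    the seminorm by (pi - nu) (z s), with pi, nu attaining it at c, gives a
    smaller differentiable function with the same value at c, whose derivative
    at c is at most -eps: a contradiction, so the maximum is at 0
    (contraction_rate_le). Conversely, if b is an admissible exponent,
    (pi - nu) (M_t (x + eps v) - M_t x) <= eps e^(bt) with equality at t = 0;
    differentiating in t at 0 and then in eps at 0 yields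
    (pi - nu) (Dphi(x) v) <= b (contraction_rate_ge).

    These arguments use that the flow solves the ODE on an open interval around
    0, hence the existence of maximal solutions (flow_is_solution): local
    solutions come from Picard iteration (picard_lindelof) and Zorn's lemma
    extends them. *)

(** * Linear maps on finite-dimensional spaces *)

Section FiniteDimensionalTopology.
Context {R : realType}.

Lemma linear_rV_continuous n (V : normedModType R)
  (f : {linear 'rV[R]_n -> V}) : continuous f.
Proof.
have -> : f = (fun a => \sum_i a 0 i *: f (delta_mx 0 i)) :> ('rV[R]_n -> V).
  apply/funext => a; rewrite {1}[a]row_sum_delta linear_sum.
  by apply: eq_bigr => i _; rewrite linearZ.
have cf i : continuous (fun a : 'rV[R]_n => a 0 i *: f (delta_mx 0 i)).
  move=> a; exact: (cvgZr_tmp (F := nbhs a) (@coord_continuous _ _ _ 0 i a)).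
move=> a; apply: (@cvg_big _ _ _ _ _ add_continuous _ (nbhs a)) => i _.
exact: cf.
Qed.

Lemma norm_coord_le n (a : 'rV[R]_n) i : `|a 0 i| <= `|a|.
Proof.
rewrite [leRHS]/Num.norm /= mx_normrE.
by apply/bigmax_geP; right => /=; exists (ord0, i).
Qed.

Lemma norm_rV_le n (a : 'rV[R]_n) (M : R) :
  0 <= M -> (forall i, `|a 0 i| <= M) -> `|a| <= M.
Proof.
move=> M0 aM; rewrite [leLHS]/Num.norm /= mx_normrE.
by apply/bigmax_leP; split => //= -[i j] _ /=; rewrite ord1.
Qed.

Lemma compact_rV n (A : set 'rV[R]_n) (M : R) :
  closed A -> (forall a, A a -> `|a| <= M) -> compact A.
Proof.
move=> cA AM; apply: bounded_closed_compact => //.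
exists M; split; first exact: num_real.
by move=> m Mm a Aa; exact: le_trans (AM a Aa) (ltW Mm).
Qed.

Lemma compact_sphere n : compact [set a : 'rV[R]_n | `|a| = 1].
Proof.
apply: (@compact_rV _ _ 1) => [|a /= ->//].
apply: (@preimage_closed _ _ (fun a : 'rV[R]_n => `|a|) [set 1]).
  by move=> a _; exact: norm_continuous.
exact: closed_eq.
Qed.

(** The norm of [f a] has a positive minimum on the compact unit sphere. This
    makes every norm of a finite-dimensional space comparable to the sup norm
    of the coordinates. *)
Lemma injective_linear_lower_bound n (V : normedModType R)
    (f : {linear 'rV[R]_n -> V}) : (forall a, f a = 0 -> a = 0) ->
  exists2 c : R, 0 < c & forall a, c * `|a| <= `|f a|.
Proof.
move=> f_inj; pose S := [set a : 'rV[R]_n | `|a| = 1].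
have [S0|S0] := pselect (S !=set0); last first.
  exists 1 => // a; have [->|a0] := eqVneq a 0; first by rewrite !normr0 mulr0.
  exfalso; apply: S0; exists (`|a|^-1 *: a).
  by rewrite /S /= normrZ normfV normr_id mulVf // normr_eq0.
have [|s] := @compact_EVT_min _ R (fun a => `|f a|) S S0 (@compact_sphere n).
  apply: continuous_subspaceT => a; apply: continuous_comp.
    exact: linear_rV_continuous.
  exact: norm_continuous.
rewrite inE => Ss smin; exists `|f s|.
  rewrite normr_gt0; apply/eqP => /f_inj s0.
  by move: Ss; rewrite /S /= s0 normr0 => /esym/eqP; rewrite oner_eq0.
move=> a; have [->|a0] := eqVneq a 0; first by rewrite normr0 mulr0.
have a0' : 0 < `|a| by rewrite normr_gt0.
have /smin : `|a|^-1 *: a \in S.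
  by rewrite inE /S /= normrZ normfV normr_id mulVf // gt_eqF.
by rewrite linearZ normrZ normfV normr_id mulrC ler_pdivlMr.
Qed.

Context {X : finDimNormedModType R}.

Lemma r2v_continuous : continuous (r2v : 'rV[R]_(dim X) -> X).
Proof. exact: linear_rV_continuous. Qed.

Lemma v2r_lipschitz : exists2 k : R, 0 < k & forall x : X, `|v2r x| <= k * `|x|.
Proof.
have [|c c0 cP] :=
  @injective_linear_lower_bound _ _ (r2v : {linear 'rV[R]_(dim X) -> X}).
  by move=> a /= /(congr1 v2r); rewrite r2vK linear0.
exists c^-1 => [|x]; first by rewrite invr_gt0.
by rewrite mulrC ler_pdivlMr // mulrC (le_trans (cP _)) //= v2rK.
Qed.

Lemma findim_linear_continuous (W : normedModType R) (f : {linear X -> W}) :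
  continuous f.
Proof.
have v2r_cont : continuous (v2r : X -> 'rV[R]_(dim X)).
  have [k k0 kP] := v2r_lipschitz.
  apply: bounded_linear_continuous; exists k; split; first exact: num_real.
  move=> m km; apply: filterS (nbhs0_le ltr01) => x x1.
  apply: le_trans (kP x) _; rewrite -[leRHS]mulr1.
  by apply: ler_pM => //; exact: ltW.
have -> : f = (f \o r2v) \o v2r :> (X -> W).
  by apply/funext => x /=; rewrite v2rK.
move=> x; apply: continuous_comp; first exact: v2r_cont.
exact: (@linear_rV_continuous _ _ (f \o r2v : {linear _ -> _})).
Qed.

End FiniteDimensionalTopology.

(** * Extreme points maximizing an affine function *)

Section Dot.
Context {R : realType} {n : nat}.
Implicit Types a b c : 'rV[R]_n.

(** The norm of a matrix is the sup norm, which is not strictly convex; the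
    Euclidean square [dot a a] is, and this detects extreme points. *)
Definition dot a b : R := \sum_i a 0 i * b 0 i.

Lemma dotC a b : dot a b = dot b a.
Proof. by apply: eq_bigr => i _; rewrite mulrC. Qed.

Lemma dotDr a b c : dot a (b + c) = dot a b + dot a c.
Proof. by rewrite -big_split; apply: eq_bigr => i _; rewrite mxE mulrDr. Qed.

Lemma dotZr a k b : dot a (k *: b) = k * dot a b.
Proof. by rewrite mulr_sumr; apply: eq_bigr => i _; rewrite mxE mulrCA. Qed.

Lemma dotBr a b c : dot a (b - c) = dot a b - dot a c.
Proof. by rewrite -scaleN1r dotDr dotZr mulN1r. Qed.

Lemma dotDl a b c : dot (a + b) c = dot a c + dot b c.
Proof. by rewrite !(dotC _ c) dotDr. Qed.

Lemma dotZl a k b : dot (k *: a) b = k * dot a b.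
Proof. by rewrite !(dotC _ b) dotZr. Qed.

Lemma dotBl a b c : dot (a - b) c = dot a c - dot b c.
Proof. by rewrite !(dotC _ c) dotBr. Qed.

Lemma dot_ge0 a : 0 <= dot a a.
Proof. by apply: sumr_ge0 => i _; rewrite -expr2 sqr_ge0. Qed.

Lemma dot_eq0 a : dot a a = 0 -> a = 0.
Proof.
move=> /psumr_eq0P a0; apply/rowP => i; rewrite mxE; apply/eqP.
by rewrite -sqrf_eq0 expr2 a0 // => j _; rewrite -expr2 sqr_ge0.
Qed.

Lemma norm_le_dot a (M : R) : 0 <= M -> dot a a <= M ^+ 2 -> `|a| <= M.
Proof.
move=> M0 aM; apply: norm_rV_le => // i.
rewrite -(@ler_pXn2r _ 2) ?nnegrE // real_normK ?num_real //.
apply: le_trans aM; rewrite /dot (bigD1 i) //= -expr2 lerDl.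
by apply: sumr_ge0 => j _; rewrite -expr2 sqr_ge0.
Qed.

Lemma dot_continuous : continuous (fun a => dot a a).
Proof.
move=> a; apply: (@cvg_big _ _ _ _ _ add_continuous _ (nbhs a)) => i _.
exact: (cvgM (F := nbhs a) (@coord_continuous _ _ _ 0 i a)
             (@coord_continuous _ _ _ 0 i a)).
Qed.

(** Strict convexity of the Euclidean square: a proper convex combination that
    is at least as long as both of its ends is trivial. *)
Lemma dot_midpoint_lt t b c : 0 < t < 1 ->
  dot b b <= dot (t *: b + (1 - t) *: c) (t *: b + (1 - t) *: c) ->
  dot c c <= dot (t *: b + (1 - t) *: c) (t *: b + (1 - t) *: c) -> b = c.
Proof.
move=> /andP[t0 t1] hb hc; apply/eqP; rewrite -subr_eq0; apply/eqP/dot_eq0.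
apply/eqP; rewrite eq_le dot_ge0 andbT.
move: hb hc; rewrite !(dotBl, dotBr, dotDl, dotDr, dotZl, dotZr) (dotC c b).
set B := dot b b; set C := dot c c; set D := dot b c => hb hc.
have tp : 0 < t * (1 - t) by rewrite mulr_gt0 // subr_gt0.
rewrite -(pmulr_rle0 _ tp).
have h : t * B + (1 - t) * C <=
    t * (t * B) + t * ((1 - t) * D) + ((1 - t) * (t * D) + (1 - t) * ((1 - t) * C)).
  set Q := (X in _ <= X).
  have -> : Q = t * Q + (1 - t) * Q by ring.
  apply: lerD; apply: ler_wpM2l => //; first exact: ltW.
  by rewrite subr_ge0 ltW.
rewrite -subr_le0 in h; apply: le_trans h.
by rewrite le_eqVlt; apply/orP; left; apply/eqP; ring.
Qed.

End Dot.

Section ExtremeMaximizer.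
Context {R : realType}.

(** Stated by the behaviour on lines, so that evaluations of functionals and
    differences of linear maps qualify without being bundled as linear maps. *)
Definition affine {V : lmodType R} (f : V -> R) : Prop :=
  forall (t : R) x y, f (t *: x + (1 - t) *: y) = t * f x + (1 - t) * f y.

(** After subtraction of its value at 0 the function is additive and
    homogeneous, hence a linear combination of the coordinates. *)
Lemma affine_continuous (V : vectType R) (f : V -> R) :
  affine f -> continuous (f \o r2v).
Proof.
move=> aff; pose h x := f x - f 0.
have hZ t x : h (t *: x) = t * h x.
  have := aff t x 0; rewrite scaler0 addr0 /h => ->; ring.
have hD : {morph h : x y / x + y >-> x + y}.
  move=> x y; have := aff 2^-1 x y.
  have -> : 1 - 2^-1 = 2^-1 :> R by lra.
  rewrite -scalerDr => e; have := hZ 2^-1 (x + y); rewrite /h e; lra.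
have -> : f \o r2v = (fun a : 'rV[R]_(dim V) =>
    (\sum_i a 0 i * h (r2v (delta_mx 0 i))) + f 0) :> (_ -> R).
  apply/funext => a /=; rewrite -[LHS](subrK (f 0)); congr (_ + _).
  rewrite -/(h _) {1}[a]row_sum_delta linear_sum.
  rewrite (big_morph h hD (id1 := 0)); last by rewrite /h subrr.
  by apply: eq_bigr => i _; rewrite linearZ hZ.
move=> a; apply: (cvgD (F := nbhs a)); last exact: cvg_cst.
apply: (@cvg_big _ _ _ _ _ add_continuous _ (nbhs a)) => i _.
exact: (cvgM (F := nbhs a) (@coord_continuous _ _ _ 0 i a) (cvg_cst _)).
Qed.

Lemma compact_max_set n (A : set 'rV[R]_n) (f : 'rV[R]_n -> R) :
  A !=set0 -> compact A -> continuous f ->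
  exists2 c, A c & forall a, A a -> f a <= f c.
Proof.
move=> A0 cA cf; have [|c] := @compact_EVT_max _ R f A A0 cA.
  exact: continuous_subspaceT.
by rewrite inE => Ac cmax; exists c => // a Aa; apply: cmax; rewrite inE.
Qed.

(** Maximize [f] on the face where [g] vanishes, and then the Euclidean square
    among the maximizers. If the point found is a proper combination of [y] and
    [z] in [K], both lie in the face, both maximize [f], and strict convexity of
    the square makes them equal. Compactness is read in coordinates, because
    the dual space carries no topology. *)
Lemma extreme_maximizer (V : vectType R) (K : set V) (g f : V -> R) (x0 : V) :
  compact [set a | K (r2v a)] -> affine g -> affine f ->
  (forall x, K x -> 0 <= g x) -> K x0 -> g x0 = 0 ->
  exists x, [/\ extreme_points K x, g x = 0 & f x0 <= f x].
Proof.
move=> cK ag af g0 Kx0 gx0.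
have closed_level (h : V -> R) r : affine h ->
    closed [set a : 'rV[R]_(dim V) | h (r2v a) = r].
  move=> ah; apply: (@preimage_closed _ _ (h \o r2v) [set r]).
    by move=> a _; exact: affine_continuous.
  exact: closed_eq.
pose A := [set a | K (r2v a)] `&` [set a | g (r2v a) = 0].
have cA : compact A by apply: compact_closedI => //; exact: closed_level.
have [|c Ac cmax] := compact_max_set (A := A) (f := f \o r2v) _ cA (affine_continuous af).
  by exists (v2r x0); split; rewrite /= v2rK.
pose B := A `&` [set a | f (r2v a) = f (r2v c)].
have cB : compact B by apply: compact_closedI => //; exact: closed_level.
have [|p [[Kp gp] fp] pmax] := compact_max_set (A := B) _ cB (@dot_continuous R _).
  by exists c.
exists (r2v p); split => //; last first.
  by rewrite fp; have /= := cmax (v2r x0); rewrite v2rK; apply; split;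
    rewrite /= v2rK.
split=> // y z t Ky Kz t01 pyz; have /andP[t0 t1] := t01.
(* Zero is a combination, with positive weights, of two nonnegative values. *)
have [gy gz] : g y = 0 /\ g z = 0.
  have := ag t y z; rewrite -pyz gp => /esym/eqP.
  have t1' : 0 < 1 - t by rewrite subr_gt0.
  rewrite paddr_eq0 ?mulr_ge0 ?g0 ?ltW // !mulf_eq0.
  by rewrite (gt_eqF t0) (gt_eqF t1') => /andP[/eqP-> /eqP->].
have fle w : K w -> g w = 0 -> f w <= f (r2v c).
  by move=> Kw gw; have /= := cmax (v2r w); rewrite v2rK; apply; split;
    rewrite /= v2rK.
have [fy fz] : f y = f (r2v c) /\ f z = f (r2v c).
  have := af t y z; rewrite -pyz fp; move: (fle _ Ky gy) (fle _ Kz gz).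
  by move=> *; split; nra.
have ple w : K w -> g w = 0 -> f w = f (r2v c) -> dot (v2r w) (v2r w) <= dot p p.
  by move=> Kw gw fw; apply: pmax; split; rewrite /= ?v2rK //; split;
    rewrite /= v2rK.
have pE : p = t *: v2r y + (1 - t) *: v2r z.
  by rewrite -[LHS]r2vK pyz linearD !linearZ.
have yz : v2r y = v2r z.
  by apply: (@dot_midpoint_lt _ _ t); rewrite // -pE; exact: ple.
have {}yz : y = z by rewrite -(v2rK y) yz v2rK.
by rewrite pyz yz -scalerDl addrC subrK scale1r.
Qed.

End ExtremeMaximizer.

(** * Duality and compactness for a proper cone *)

(** The first-order condition for a quadratic polynomial that is minimal at 0
    on [0, 1]. *)
Lemma quadratic_slope_ge0 (R : realType) (u v : R) : 0 <= v ->
  (forall s, 0 < s -> s <= 1 -> 0 <= 2 * s * u + s ^+ 2 * v) -> 0 <= u.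
Proof.
move=> v0 H; rewrite leNgt; apply/negP => u0.
have d0 : 0 < v - u by rewrite subr_gt0 (lt_le_trans u0).
(* With this step the quadratic term is too small to compensate the linear
   one. *)
pose s := - u / (v - u).
have su : s * (v - u) = - u by rewrite divfK // gt_eqF.
have s0 : 0 < s by rewrite divr_gt0 // oppr_gt0.
have s1 : s <= 1 by rewrite ler_pdivrMr // mul1r; lra.
have := H s s0 s1; rewrite leNgt => /negP; apply.
have -> : 2 * s * u + s ^+ 2 * v = s * (2 * u + s * (v - u) + s * u).
  by ring.
rewrite su; have : s * u < 0 by rewrite pmulr_rlt0.
by move=> su0; rewrite pmulr_rlt0 //; lra.
Qed.

Section Cone.
Context {R : realType} {X : finDimNormedModType R}.
Variables (C : set X) (e : X).
Hypotheses (C_closed : closed C) (C_cone : convex_cone C).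
Hypotheses (C_pointed : pointed_cone C) (e_int : interior C e).

Let CD x y : C x -> C y -> C (x + y). Proof. exact: C_cone.1. Qed.
Let CZ (a : R) x : 0 <= a -> C x -> C (a *: x). Proof. exact: C_cone.2. Qed.
Let Ce : C e. Proof. exact: interior_subset. Qed.
Let C0 : C 0. Proof. by rewrite -(scale0r e); exact: CZ. Qed.

Lemma pointed_eq0 x : C x -> C (- x) -> x = 0.
Proof.
move=> Cx CNx; have : (C `&` [set x | C (- x)]) x by [].
by rewrite C_pointed.
Qed.

Let closed_pull : closed [set a : 'rV[R]_(dim X) | C (r2v a)].
Proof.
apply: (@preimage_closed _ _ (r2v : 'rV[R]_(dim X) -> X) C) => // a _.
exact: r2v_continuous.
Qed.

(** The functional is the Euclidean product with [p - a0], where [p] is the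
    point of the cone nearest to [a0], the coordinates of [w]. Moving [p] in a
    direction of the cone, or shrinking [p], cannot decrease the distance; this
    makes the functional nonnegative on the cone and nonpositive at [p]. *)
Lemma cone_separation w : ~ C w ->
  exists2 mu : 'Hom(X, R^o), dual_cone C mu & mu w < 0.
Proof.
move=> Cw; pose a0 := v2r w.
pose q (a : 'rV[R]_(dim X)) := dot (a - a0) (a - a0).
have q_cont : continuous q.
  have subr_cont : continuous (fun a : 'rV[R]_(dim X) => a - a0).
    by move=> a; exact: (cvgB (F := nbhs a) cvg_id (cvg_cst _)).
  by move=> a; exact: (continuous_comp (subr_cont a) (@dot_continuous R _ _)).
pose D := [set a | C (r2v a)] `&` [set a | q a <= dot a0 a0].
have cD : compact D.
  apply: (@compact_rV _ _ _ (`|a0| + (1 + dot a0 a0))).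
    apply: closedI => //;
      apply: (@preimage_closed _ _ q [set r | r <= dot a0 a0]).
      by move=> a _; exact: q_cont.
    exact: closed_le.
  move=> a [_ /= qa]; rewrite -{1}(subrKC a0 a);
    apply: le_trans (ler_normD _ _) _.
  rewrite lerD2l; have d0 := dot_ge0 a0.
  apply: norm_le_dot; first by rewrite addr_ge0.
  by apply: le_trans qa _; nra.
have D0 : D !=set0.
  by exists 0; split; rewrite /= ?linear0 // /q sub0r -scaleN1r dotZl dotZr; lra.
have [|p [Cp qp] pmin] := compact_max_set (f := fun a => - q a) D0 cD.
  by move=> a; apply: (cvgN (F := nbhs a)); exact: q_cont.
have {}pmin a : C (r2v a) -> q p <= q a.
  move=> Ca; have [qa|/ltW qa] := leP (q a) (dot a0 a0).
    by rewrite -lerN2; apply: pmin.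
  exact: le_trans qp qa.
have expand v s : q (p + s *: v) = q p + (2 * s * dot (p - a0) v + s ^+ 2 * dot v v).
  rewrite /q (addrAC p); move: (p - a0) => u.
  rewrite dotDl !dotDr !dotZl !dotZr (dotC v u); ring.
have ge0 c : C (r2v c) -> 0 <= dot (p - a0) c.
  move=> Cc; apply: (@quadratic_slope_ge0 _ _ (dot c c)) => [|s s0 _]; first exact: dot_ge0.
  rewrite -(lerDl (q p)) -expand; apply: pmin.
  by rewrite linearD linearZ; apply: CD => //; apply: CZ => //; exact: ltW.
have le0 : dot (p - a0) p <= 0.
  rewrite -oppr_ge0; apply: (@quadratic_slope_ge0 _ _ (dot p p)) => [|s s0 s1];
    first exact: dot_ge0.
  have -> : 2 * s * - dot (p - a0) p + s ^+ 2 * dot p p =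
    2 * (- s) * dot (p - a0) p + (- s) ^+ 2 * dot p p by ring.
  rewrite -(lerDl (q p)) -expand; apply: pmin.
  rewrite linearD linearZ /= scaleNr -{1}(scale1r (r2v p)) -scalerBl.
  by apply: CZ => //; rewrite subr_ge0.
have mu_lin : linear (fun x : X => dot (p - a0) (v2r x) : R^o).
  by move=> k x y; rewrite linearP dotDr dotZr.
pose muL := GRing.isLinear.Build _ _ _ _ _ mu_lin.
pose muF : {linear X -> R^o} := HB.pack (fun x : X => dot (p - a0) (v2r x) : R^o) muL.
exists (linfun muF); first by move=> x Cx; rewrite lfunE /=; apply: ge0;
  rewrite v2rK.
rewrite lfunE /= -/a0.
have -> : dot (p - a0) a0 = dot (p - a0) p - q p by rewrite /q !dotBr; ring.
have : q p != 0.
  apply/eqP => /dot_eq0/eqP; rewrite subr_eq0 => /eqP pa0.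
  by apply: Cw; rewrite -(v2rK w) -/a0 -pa0.
have := dot_ge0 (p - a0); rewrite -/(q p) le_eqVlt eq_sym => /orP[/eqP->|];
  first by rewrite eqxx.
by move=> h _; lra.
Qed.

Lemma unit_interior_ball : exists2 r : R, 0 < r & forall v, `|v| < r -> C (e + v).
Proof.
move: e_int => /nbhs_ballP[r /= r0 rC]; exists r => // v vr; apply: rC.
by rewrite -ball_normE /= opprD addNKr normrN.
Qed.

(** As [e] is interior, [e + s *: w] is in the cone for some [s > 0], and [mu e]
    has to compensate [s * mu w < 0]. *)
Lemma dual_cone_pos (mu : 'Hom(X, R^o)) w : dual_cone C mu -> mu w < 0 -> 0 < mu e.
Proof.
move=> mu0 muw; have [r r0 rC] := unit_interior_ball.
have w0 : 0 < `|w|.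
  by rewrite normr_gt0; apply/eqP => w0; move: muw; rewrite w0 linear0 ltxx.
pose s := r / (2 * `|w|).
have s0 : 0 < s by rewrite divr_gt0 // mulr_gt0.
have : C (e + s *: w).
  apply: rC; rewrite normrZ gtr0_norm // /s invfM mulrA mulfVK ?gt_eqF //.
  lra.
move=> /mu0; rewrite linearD linearZ /= -[s *: mu w]/(s * mu w) => h.
have : s * mu w < 0 by rewrite pmulr_rlt0.
by move=> ?; lra.
Qed.

Lemma normalize_dual (mu : 'Hom(X, R^o)) w : dual_cone C mu -> mu w < 0 ->
  exists2 nu, simplex C e nu & nu w < 0.
Proof.
move=> mu0 muw; have mue := dual_cone_pos mu0 muw.
exists ((mu e)^-1 *: mu); last first.
  rewrite lfunE /= -[_ *: mu w]/(_ * mu w : R).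
  by rewrite pmulr_rlt0 // invr_gt0.
split=> [x Cx|]; rewrite lfunE /=.
  by apply: mulr_ge0; [rewrite invr_ge0 ltW|exact: mu0].
by apply: mulVf; rewrite gt_eqF.
Qed.

Lemma simplex_separation w : ~ C w -> exists2 nu, simplex C e nu & nu w < 0.
Proof.
by move=> /cone_separation[mu mu0 muw]; exact: normalize_dual mu0 muw.
Qed.

Lemma simplex_nonempty : e != 0 -> exists nu, simplex C e nu.
Proof.
move=> e0; have [|nu nuP _] := @simplex_separation (- e); last by exists nu.
by move=> Ce'; move/eqP: e0; apply; exact: pointed_eq0.
Qed.

(** A small multiple [s *: v] satisfies [- e <= s *: v <= e], which bounds every
    normalized positive functional. *)
Lemma simplex_bounded :
  exists2 k : R, 0 < k & forall (nu : 'Hom(X, R^o)) v, simplex C e nu ->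
    `|nu v : R| <= k * `|v|.
Proof.
have [r r0 rC] := unit_interior_ball.
exists (2 / r) => [|nu v [nu0 nue]]; first by rewrite divr_gt0.
have [->|v0] := eqVneq v 0; first by rewrite linear0 !normr0 mulr0.
have v0' : 0 < `|v| by rewrite normr_gt0.
pose s := r / (2 * `|v|).
have s0 : 0 < s by rewrite divr_gt0 // mulr_gt0.
have sv : `|s *: v| < r.
  rewrite normrZ gtr0_norm // /s invfM mulrA mulfVK ?gt_eqF //; lra.
have h1 := nu0 _ (rC _ sv).
have h2 : 0 <= nu (e + - (s *: v)) by apply/nu0/rC; rewrite normrN.
move: h1 h2; rewrite linearB linearD linearZ /=. rewrite nue => h1 h2.
have -> : 2 / r * `|v| = s^-1 by rewrite /s invfM invrK; field; rewrite !gt_eqF.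
rewrite -(ler_pM2l s0) divff ?gt_eqF // -[s in s * _]gtr0_norm // -normrM ler_norml.
move: h1 h2; rewrite -[s *: nu v]/(s * nu v) => h1 h2; apply/andP; split; lra.
Qed.

(** Closedness is clear, since evaluations are continuous. For boundedness, a
    functional is controlled by its values on a basis, which are bounded by
    [simplex_bounded]. *)
Lemma compact_simplex :
  compact [set a : 'rV[R]_(dim 'Hom(X, R^o)) | simplex C e (r2v a)].
Proof.
pose ev (x : X) (a : 'rV[R]_(dim 'Hom(X, R^o))) : R := r2v a x.
have ev_cont x : continuous (ev x).
  apply: (@affine_continuous _ 'Hom(X, R^o) (fun mu => mu x)) => t mu nu.
  by rewrite add_lfunE !scale_lfunE.
have f_lin : linear (fun a : 'rV[R]_(dim 'Hom(X, R^o)) =>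
    \row_i ev (r2v (delta_mx 0 i : 'rV_(dim X))) a).
  by move=> k a b; apply/rowP => i;
    rewrite !mxE /ev linearP add_lfunE scale_lfunE.
pose fL := GRing.isLinear.Build _ _ _ _ _ f_lin.
pose f : {linear _ -> _} := HB.pack (fun a : 'rV[R]_(dim 'Hom(X, R^o)) =>
    \row_i ev (r2v (delta_mx 0 i : 'rV_(dim X))) a) fL.
have [a fa0|c c0 cP] := @injective_linear_lower_bound R _ _ f.
  apply/r2v_inj; rewrite linear0; apply/lfunP => x; rewrite lfunE /=.
  rewrite -(v2rK x) [v2r x]row_sum_delta !linear_sum big1 // => i _.
  rewrite !linearZ /=; have := congr1 (fun b : 'rV_(dim X) => b 0 i) fa0.
  by rewrite !mxE /ev => ->; rewrite scaler0.
have [k k0 kP] := simplex_bounded.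
have [m m0 mP] := @v2r_lipschitz R X.
have [N N0 NP] : exists2 N : R, 0 <= N &
    forall i, `|r2v (delta_mx 0 i : 'rV_(dim X)) : X| <= N.
  exists (\sum_i `|r2v (delta_mx 0 i : 'rV_(dim X)) : X|).
    by apply: sumr_ge0 => i _.
  by move=> i; rewrite (bigD1 i) //= lerDl sumr_ge0.
apply: (@compact_rV _ _ _ (c^-1 * (k * N))).
  have -> : [set a | simplex C e (r2v a)] =
      (\bigcap_(x in C) [set a | 0 <= ev x a]) `&` [set a | ev e a = 1].
    by rewrite predeqE => a; split.
  apply: closedI.
    apply: closed_bigI => x Cx.
    apply: (@preimage_closed _ _ (ev x) [set r | 0 <= r]); last exact: closed_ge.
    by move=> a _; exact: ev_cont.
  apply: (@preimage_closed _ _ (ev e) [set 1]); last exact: closed_eq.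
  by move=> a _; exact: ev_cont.
move=> a aP; rewrite mulrC ler_pdivlMr // mulrC; apply: le_trans (cP a) _.
apply: norm_rV_le => [|i]; first by rewrite mulr_ge0 // ltW.
rewrite mxE; apply: le_trans (kP _ _ aP) _.
by rewrite ler_pM2l.
Qed.

(** For boundedness, let [d] be the smallest [s] in [0, 1] (if there is one) such
    that [0 <= a <= s *: e] for some [a] of norm 1. As the cone is pointed, [d > 0]:
    otherwise [a] and [- a] would both be positive. By scaling, [d^-1] bounds the
    elements of the interval that are longer than 1. *)
Lemma compact_order_interval :
  compact [set a : 'rV[R]_(dim X) | order_interval C 0 e (r2v a)].
Proof.
pose T := ('rV[R]_(dim X) * R)%type.
pose S := ([set a : 'rV[R]_(dim X) | `|a| = 1] `*` `[0, 1]%classic) : set T.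
pose K : set T := S `&`
  ([set u | C (r2v u.1)] `&` [set u | C (u.2 *: e - r2v u.1)]).
have K_closed : closed ([set u : T | C (r2v u.1)] `&` [set u | C (u.2 *: e - r2v u.1)]).
  have fst_cont : continuous (fun u : T => r2v u.1 : X).
    move=> u; apply: continuous_comp; [exact: cvg_fst|exact: r2v_continuous].
  apply: closedI.
    by apply: (@preimage_closed _ _ (fun u : T => r2v u.1 : X)).
  apply: (@preimage_closed _ _ (fun u : T => u.2 *: e - r2v u.1 : X)) => //.
  move=> u _; apply: (cvgB (F := nbhs u)); last exact: fst_cont.
  by apply: (cvgZr_tmp (F := nbhs u)); exact: cvg_snd.
have K_compact : compact K.
  apply: compact_closedI => //; apply: compact_setX; first exact: compact_sphere.
  exact: segment_compact.
have [d d0 dP] : exists2 d : R, 0 < d & forall a s, K (a, s) -> d <= s.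
  have [K0|K0] := pselect (K !=set0); last first.
    by exists 1 => // a s Kas; exfalso; apply: K0; exists (a, s).
  have [|[a s]] := @compact_EVT_min _ R snd K K0 K_compact.
    by apply: continuous_subspaceT => u; exact: cvg_snd.
  rewrite inE => -[[/= a1]]; rewrite in_itv /= => /andP[s0 s1] [Ca Csa] smin.
  exists s; last by move=> b t Kbt; apply: (smin (b, t)); rewrite inE.
  rewrite lt_neqAle s0 andbT; apply/eqP => s0'; move: Csa;
    rewrite /= -s0' scale0r sub0r.
  move=> /(pointed_eq0 Ca)/(congr1 v2r); rewrite r2vK linear0 => a0.
  by move: a1; rewrite a0 normr0 => /esym/eqP; rewrite oner_eq0.
apply: (@compact_rV _ _ _ (1 + d^-1)).
  have -> : [set a : 'rV[R]_(dim X) | order_interval C 0 e (r2v a)] =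
      [set a | C (r2v a)] `&` [set a | C (e - r2v a)].
    by rewrite predeqE => a; rewrite /order_interval /cone_le /= subr0.
  apply: closedI => //.
  apply: (@preimage_closed _ _ (fun a : 'rV[R]_(dim X) => e - r2v a : X) C) => // a _.
  by apply: (cvgB (F := nbhs a)); [exact: cvg_cst|exact: r2v_continuous].
move=> a []; rewrite /cone_le subr0 => Ca Cea.
have [a1|a1] := leP `|a| 1; first by rewrite (le_trans a1) // lerDl invr_ge0 ltW.
have a0 : 0 < `|a| by rewrite (lt_trans ltr01).
suff : d <= `|a|^-1.
  by move=> h; rewrite -(invrK `|a|) (le_trans (_ : _ <= d^-1)) ?lerDr // lef_pV2 // posrE invr_gt0.
apply: (dP (`|a|^-1 *: a)); split; split => /=.
- by rewrite normrZ normfV normr_id mulVf // gt_eqF.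
- by rewrite in_itv /= invr_ge0 ltW //= invf_le1 // ltW.
- by rewrite linearZ; apply: CZ => //; rewrite invr_ge0 ltW.
- by rewrite linearZ -scalerBr; apply: CZ => //; rewrite invr_ge0 ltW.
Qed.

End Cone.

(** * Hopf's seminorm and the functional h *)

Section Hopf.
Context {R : realType} {X : finDimNormedModType R}.
Variables (C : set X) (e : X).
Hypotheses (C_closed : closed C) (C_cone : convex_cone C).
Hypotheses (C_pointed : pointed_cone C) (e_int : interior C e).
Implicit Types (nu pi : 'Hom(X, R^o)) (z x : X).

Let CZ (a : R) x : 0 <= a -> C x -> C (a *: x). Proof. exact: C_cone.2. Qed.
Let Ce : C e. Proof. exact: interior_subset. Qed.
Let C0 : C 0. Proof. by rewrite -(scale0r e); exact: CZ. Qed.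

Lemma simplex_le nu z (t : R) : simplex C e nu -> C (t *: e - z) -> nu z <= t.
Proof.
move=> [nu0 nue] /nu0; rewrite linearB linearZ /= nue -[t *: 1]/(t * 1).
by rewrite mulr1 subr_ge0.
Qed.

Lemma simplex_ge nu z (t : R) : simplex C e nu -> C (z - t *: e) -> t <= nu z.
Proof.
move=> nuS Cz; rewrite -lerN2 -linearN; apply: simplex_le => //.
by rewrite scaleNr opprK addrC.
Qed.

Lemma hopf_ge pi nu z : simplex C e pi -> simplex C e nu ->
  ((pi z - nu z : R)%:E <= hopf_seminorm C e z)%E.
Proof.
move=> piS nuS; rewrite EFinB; apply: leeB.
  by apply: le_ereal_inf_tmp => _ [t /= tP <-]; rewrite lee_fin;
    exact: simplex_le.
by apply: ge_ereal_sup => _ [t /= tP <-]; rewrite lee_fin; exact: simplex_ge.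
Qed.

Lemma hopf_le z (a b : R) : C (a *: e - z) -> C (z - b *: e) ->
  (hopf_seminorm C e z <= (a - b)%:E)%E.
Proof.
move=> Ca Cb; rewrite EFinB; apply: leeB.
  by apply: ereal_inf_lbound; exists a.
by apply: ereal_sup_ubound; exists b.
Qed.

(** If [e = 0] then the interior of the cone contains 0 and the cone is the
    whole space. *)
Lemma hopf_unit0 z : e = 0 -> hopf_seminorm C e z = -oo%E.
Proof.
move=> e0; have CT x : C x.
  have [r r0 rC] := unit_interior_ball e_int.
  have [->//|x0] := eqVneq x 0.
  have xp : 0 < `|x| by rewrite normr_gt0.
  have s0 : 0 < r / (2 * `|x|) by rewrite divr_gt0 ?mulr_gt0.
  rewrite -[x](scalerK (lt0r_neq0 s0)); apply: CZ; first by rewrite invr_ge0 ltW.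
  rewrite -[_ *: x]add0r -e0; apply: rC.
  by rewrite normrZ gtr0_norm // invfM mulrA mulfVK ?gt_eqF //; lra.
rewrite /hopf_seminorm; have -> : [set t | cone_le C z (t *: e)] = [set: R].
  by rewrite predeqE => t; split => // _; exact: CT.
by rewrite ereal_inf_real.
Qed.

(** The functional that maximizes [mu z] on the simplex: if [z] were not below
    [pi z *: e], a separating functional would have a larger value at [z]. *)
Lemma simplex_max z : e != 0 ->
  exists2 pi, simplex C e pi & C (pi z *: e - z).
Proof.
move=> e0; have [pi0 pi0S] := simplex_nonempty C_closed C_cone C_pointed e_int e0.
have aff : affine (fun mu : 'Hom(X, R^o) => mu z).
  by move=> t mu nu; rewrite add_lfunE !scale_lfunE.
have [|c cS cmax] := compact_max_set _ (compact_simplex e_int)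
    (affine_continuous aff).
  by exists (v2r pi0); rewrite /= v2rK.
exists (r2v c) => //; apply: contrapT => /(simplex_separation C_closed C_cone e_int).
move=> [nu nuS]; rewrite linearB linearZ /= nuS.2 subr_lt0 -[_ *: 1]/(_ * 1 : R) mulr1.
by have /= := cmax (v2r nu); rewrite v2rK => /(_ nuS); rewrite leNgt => /negP.
Qed.

Lemma simplex_min z : e != 0 ->
  exists2 nu, simplex C e nu & C (z - nu z *: e).
Proof.
move=> /(simplex_max (- z))[nu nuS Cnu]; exists nu => //.
by move: Cnu; rewrite linearN scaleNr opprK addrC.
Qed.

Lemma hopf_attained z : e != 0 -> exists pi nu,
  [/\ simplex C e pi, simplex C e nu & hopf_seminorm C e z = (pi z - nu z : R)%:E].
Proof.
move=> e0; have [pi piS Cpi] := simplex_max z e0;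
  have [nu nuS Cnu] := simplex_min z e0.
exists pi, nu; split=> //; apply/eqP; rewrite eq_le hopf_ge // andbT.
exact: hopf_le.
Qed.

(** The constraint [nu x + pi (e - x) = 0] has two nonnegative terms, so it says
    that [nu x = 0] and [pi x = 1]; and [L (e - x) = - L x]. *)
Lemma hopf_h_le (L : {linear X -> X}) (b : R) : L e = 0 ->
  (forall pi nu x, simplex C e pi -> simplex C e nu -> C x -> C (e - x) ->
     nu x = 0 -> pi x = 1 -> pi (L x) - nu (L x) <= b :> R) ->
  (hopf_h C e L <= b%:E)%E.
Proof.
move=> Le H; rewrite /hopf_h leeNl;
  apply: le_ereal_inf_tmp => _ [nu nuS [pi piS <-]].
apply: le_ereal_inf_tmp => _ [x [[[Cx Cex] _] /= x0] <-];
  rewrite -[X in (X <= _)%E]/((- b)%:E) lee_fin.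
have Cx' : C x by move: Cx; rewrite /cone_le subr0.
have nu0 : 0 <= nu x by apply: nuS.1.1.
have pi0 : 0 <= pi (e - x) by apply: piS.1.1.
move/eqP: x0; rewrite paddr_eq0 // => /andP[/eqP nux /eqP].
rewrite linearB /= piS.1.2 => /eqP; rewrite subr_eq0 => /eqP/esym pix.
have := H pi nu x piS.1 nuS.1 Cx' Cex nux pix.
rewrite [L (e - x)]linearB Le sub0r [pi (- _)]linearN; lra.
Qed.

Lemma hopf_h_extreme (L : {linear X -> X}) (b : R) pi nu x : L e = 0 ->
  (hopf_h C e L <= b%:E)%E ->
  extreme_points (simplex C e) pi -> extreme_points (simplex C e) nu ->
  extreme_points (order_interval C 0 e) x -> nu x = 0 -> pi (e - x) = 0 ->
  pi (L x) - nu (L x) <= b :> R.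
Proof.
move=> Le; rewrite /hopf_h leeNl => hb piE nuE xE nux pix.
have : ((- b)%:E <= (nu (L x) + pi (L (e - x)) : R)%:E)%E.
  apply: le_trans hb _; apply: (@le_trans _ _ (ereal_inf [set
       (nu (L x) + pi (L (e - x)))%R%:E | x in
         [set x | extreme_points (order_interval C 0%R e) x /\
                  (nu x + pi (e - x) = 0)%R]])).
    by apply: ereal_inf_lbound; exists nu => //; exists pi.
  by apply: ereal_inf_lbound; exists x => //; split=> //; rewrite nux pix addr0.
rewrite lee_fin [L (e - x)]linearB Le sub0r [pi (- _)]linearN /=; lra.
Qed.

(** The functionals vanishing at a given positive [x] form a face of the
    simplex. *)
Lemma simplex_face_maximizer nu x (f : 'Hom(X, R^o) -> R) : C x -> affine f ->
  simplex C e nu -> nu x = 0 ->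
  exists nu', [/\ extreme_points (simplex C e) nu', nu' x = 0 & f nu <= f nu'].
Proof.
move=> Cx af nuS nux.
apply: (extreme_maximizer (g := fun mu : 'Hom(X, R^o) => mu x)) => //.
- exact: compact_simplex.
- by move=> t mu mu'; rewrite add_lfunE !scale_lfunE.
- by move=> mu [mu0 _]; exact: mu0.
Qed.

(** The three arguments are made extreme one after the other, [nu], then [pi],
    then [x]; each replacement stays in the face given by the constraints and
    does not decrease [pi (L x) - nu (L x)]. *)
Lemma hopf_h_unit (L : {linear X -> X}) (b : R) pi nu x : L e = 0 ->
  (hopf_h C e L <= b%:E)%E -> simplex C e pi -> simplex C e nu ->
  C x -> C (e - x) -> nu x = 0 -> pi x = 1 -> pi (L x) - nu (L x) <= b :> R.
Proof.
move=> Le hb piS nuS Cx Cex nux pix.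
have eval_affine y : affine (fun mu : 'Hom(X, R^o) => mu y).
  by move=> t mu mu'; rewrite add_lfunE !scale_lfunE.
have [|nu' [nuE nux' nuL]] :=
    @simplex_face_maximizer nu x (fun mu => - mu (L x)) Cx _ nuS nux.
  by move=> t mu mu'; rewrite eval_affine; ring.
have [|pi' [piE pix' piL]] :=
    @simplex_face_maximizer pi (e - x) _ Cex (eval_affine (L x)) piS.
  by rewrite linearB /= piS.2 pix subrr.
have nuS' := nuE.1; have piS' := piE.1.
have [||||||x' [xE gx fx]] := @extreme_maximizer R X (order_interval C 0 e)
    (fun y => nu' y + pi' (e - y)) (fun y => pi' (L y) - nu' (L y)) x.
- exact: compact_order_interval.
- move=> t y z; have -> : e - (t *: y + (1 - t) *: z) =
      t *: (e - y) + (1 - t) *: (e - z).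
    by rewrite !scalerBr addrACA -opprD -scalerDl subrKC scale1r.
  rewrite !linearD !linearZ /= -?[_ *: (_ : R^o)]/(_ * _); ring.
- move=> t y z; rewrite !linearD !linearZ /= -?[_ *: (_ : R^o)]/(_ * _); ring.
- move=> y [+ Cey]; rewrite /cone_le subr0 => Cy.
  by apply: addr_ge0; [exact: nuS'.1|exact: piS'.1].
- by split; rewrite /cone_le ?subr0.
- by rewrite nux' pix' addr0.
have Cx' := xE.1.1; rewrite /cone_le subr0 in Cx'; have Cex' := xE.1.2.
move/eqP: gx; rewrite paddr_eq0; [|exact: nuS'.1|exact: piS'.1].
move=> /andP[/eqP nu0 /eqP pi0].
have := hopf_h_extreme Le hb piE nuE xE nu0 pi0; lra.
Qed.

(** With [m] and [M] the extreme values of the simplex at [z], the point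
    [(z - m *: e) / (M - m)] lies in the order interval, and [L] does not see
    the translation along [e]. If [M = m] then [z] is a multiple of [e]. *)
Lemma hopf_h_maximizer (L : {linear X -> X}) (b : R) pi nu z : L e = 0 ->
  (hopf_h C e L <= b%:E)%E -> simplex C e pi -> simplex C e nu ->
  hopf_seminorm C e z = (pi z - nu z : R)%:E ->
  pi (L z) - nu (L z) <= b * (pi z - nu z) :> R.
Proof.
move=> Le hb piS nuS hz.
have e0 : e != 0.
  apply/eqP => e0; have := piS.2; rewrite e0 linear0 => /esym/eqP.
  by rewrite oner_eq0.
have [pi' piS' Cpi] := simplex_max z e0; have [nu' nuS' Cnu] := simplex_min z e0.
have pi_le := simplex_le piS Cpi; have nu_ge := simplex_ge nuS Cnu.
have : (pi' z - nu' z <= pi z - nu z :> R).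
  by rewrite -lee_fin -hz; exact: hopf_ge.
set M := pi' z in Cpi pi_le *; set m := nu' z in Cnu nu_ge *.
move=> Mm; have piM : pi z = M by apply/eqP; rewrite eq_le pi_le /=; lra.
have num : nu z = m by apply/eqP; rewrite eq_le nu_ge andbT; lra.
rewrite piM num; have : 0 <= M - m by rewrite subr_ge0 -piM;
  exact: simplex_ge Cnu.
rewrite le_eqVlt => /orP[/eqP Mm0|Mm0].
  have zE : z = M *: e.
    apply/eqP; rewrite -subr_eq0; apply/eqP.
    apply: (pointed_eq0 C_pointed); last by rewrite opprB.
    by have -> : M = m by lra.
  by rewrite -Mm0 mulr0 zE linearZ /= Le scaler0 !linear0 addr0.
pose x := (M - m)^-1 *: (z - m *: e).
have lamM : (M - m)^-1 * (M - m) = 1 by rewrite mulVf // gt_eqF.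
have l0 : 0 <= (M - m)^-1 by rewrite invr_ge0 ltW.
have Cx : C x by exact: CZ.
have Cex : C (e - x).
  have -> : e - x = (M - m)^-1 *: (M *: e - z).
    rewrite /x -{1}[e]scale1r -lamM -scalerA -scalerBr scalerBl; congr (_ *: _).
    by rewrite opprB addrA subrK.
  exact: CZ.
have evx (mu : 'Hom(X, R^o)) : simplex C e mu -> mu x = (M - m)^-1 * (mu z - m) :> R.
  move=> muS; rewrite /x linearZ linearB linearZ /= muS.2.
  by rewrite -[m *: _]/(m * 1) mulr1.
have := hopf_h_unit Le hb piS nuS Cx Cex.
rewrite !evx // piM num subrr mulr0 => /(_ erefl lamM).
rewrite /x linearZ linearB [L (m *: e)]linearZ /= Le scaler0 subr0 !linearZ /=.
rewrite -scalerDr -[_ *: _]/(_ * (pi (L z) - nu (L z))) mulrC.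
by rewrite ler_pdivrMr.
Qed.

End Hopf.

(** * Derivatives along curves *)

Section Derivatives.
Context {R : realType}.

Lemma is_derive_cvgP (V W : normedModType R) (f : V -> W) x v d :
  is_derive x v f d <->
  (fun h : R => h^-1 *: (f (h *: v + x) - f x)) @ 0^' --> d.
Proof.
split=> [[df <-]|df]; first exact: df.
by split; [apply/cvg_ex; exists d|exact: cvg_lim].
Qed.

Lemma is_derive_linear (V W W' : normedModType R) (l : {linear W -> W'})
    (f : V -> W) x v d : continuous l ->
  is_derive x v f d -> is_derive x v (l \o f) (l d).
Proof.
move=> cl /is_derive_cvgP df; apply/is_derive_cvgP.
have -> : (fun h : R => h^-1 *: ((l \o f) (h *: v + x) - (l \o f) x)) =
    l \o (fun h : R => h^-1 *: (f (h *: v + x) - f x)).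
  by apply/funext => h; rewrite /= linearZ [l (_ - _)]linearB.
apply: cvg_comp. exact: df. exact: cl.
Qed.

Lemma is_derive_line (V W : normedModType R) (f : V -> W) y z (s : R) :
  differentiable f (y + s *: z) ->
  is_derive s (1 : R) (fun r : R => f (y + r *: z)) ('d f (y + s *: z) z).
Proof.
move=> df; have /is_derive_cvgP H : is_derive (y + s *: z) z f ('d f (y + s *: z) z).
  rewrite -deriveE //. apply: derivableP; exact: diff_derivable.
apply/is_derive_cvgP; rewrite [X in X @ _ --> _](_ : _ =
  (fun h : R => h^-1 *: (f (h *: z + (y + s *: z)) - f (y + s *: z)))) //.
by apply/funext => h; rewrite -[h *: 1]/(h * 1) mulr1 scalerDl addrCA.
Qed.

(** One-sided versions of Fermat's rule; the maximum is only required on one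
    side of [c], which may be an end of the interval considered. *)
Lemma derive_right_max (f : R -> R) (c d : R) : is_derive c (1 : R) f d ->
  (\forall h \near 0^'+, f (h + c) <= f c) -> d <= 0.
Proof.
move=> /is_derive_cvgP/cvg_dnbhs_at_right df fc.
apply: (cvgr_to_le df); near=> h; rewrite -[h *: 1]/(h * 1) mulr1.
rewrite -[_ *: _]/(_ * _ : R) pmulr_rle0 ?subr_le0.
  by near: h.
by rewrite invr_gt0; near: h; exact: nbhs_right_gt.
Unshelve. all: by end_near. Qed.

Lemma derive_left_max (f : R -> R) (c d : R) : is_derive c (1 : R) f d ->
  (\forall h \near 0^'-, f (h + c) <= f c) -> 0 <= d.
Proof.
move=> /is_derive_cvgP/cvg_dnbhs_at_left df fc.
apply: (cvgr_to_ge df); near=> h; rewrite -[h *: 1]/(h * 1) mulr1.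
rewrite -[_ *: _]/(_ * _ : R) nmulr_rge0 ?subr_le0.
  by near: h.
by rewrite invr_lt0; near: h; exact: nbhs_left_lt.
Unshelve. all: by end_near. Qed.

(** The mean value theorem fails for vector-valued maps but holds for their
    composition with a linear functional. *)
Lemma mean_value_functional (V W : normedModType R) (l : {linear W -> R^o})
    (f : V -> W) y z : continuous l -> (forall x, differentiable f x) ->
  exists2 s : R, 0 < s < 1 &
    l (f (y + z)) - l (f y) = l ('d f (y + s *: z) z).
Proof.
move=> cl df; pose g (s : R) : R := l (f (y + s *: z)).
have dg s : is_derive s (1 : R) g (l ('d f (y + s *: z) z)).
  by apply: (is_derive_linear (l := l) cl); apply: is_derive_line.
have cg : continuous g.
  move=> s; apply: differentiable_continuous; apply/derivable1_diffP.
  exact: (@ex_derive _ _ _ _ _ _ _ (dg s)).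
have [s sI] := MVT ltr01 (fun s _ => dg s) (continuous_subspaceT cg).
rewrite subr0 mulr1 /g scale1r scale0r addr0 => E.
by exists s => //; move: sI; rewrite in_itv.
Qed.

Lemma mean_value_bound (F dF : R -> R) (r B : R) : 0 < r -> 0 <= B ->
  (forall t, - r < t < r -> is_derive t (1 : R) F (dF t)) ->
  (forall t, - r < t < r -> `|dF t| <= B) ->
  forall t, - r < t < r -> `|F t - F 0| <= B * `|t|.
Proof.
move=> r0 B0 HF HB; have main a b : - r < a -> a <= b -> b < r ->
    `|F b - F a| <= B * (b - a).
  move=> ra ab br.
  have inr t : a <= t <= b -> - r < t < r.
    by move=> /andP[at_ tb]; rewrite (lt_le_trans ra at_) (le_lt_trans tb br).
  have [t tI||c cI ->] := @MVT_segment R F dF a b ab.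
  - by apply: HF; apply: inr; move: tI; rewrite in_itv /= => /andP[/ltW-> /ltW->].
  - apply: derivable_within_continuous => t tI.
    apply: (@ex_derive _ _ _ _ _ _ _ (HF t _)); apply: inr; move: tI.
    by rewrite in_itv.
  rewrite normrM [`|b - a|]ger0_norm ?subr_ge0 //; apply: ler_wpM2r.
    by rewrite subr_ge0.
  by apply: HB; apply: inr; move: cI; rewrite in_itv.
move=> t /andP[rt tr]; have [t0|t0] := leP 0 t.
  by have := main 0 t; rewrite subr0 (ger0_norm t0); apply=> //; rewrite oppr_lt0.
by have := main t 0; rewrite sub0r (ltr0_norm t0) distrC; apply=> //; exact: ltW.
Qed.

End Derivatives.

Lemma is_derive_expRM {R : realType} (b c : R) :
  is_derive c (1 : R) (fun s : R => expR (b * s)) (b * expR (b * c)).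
Proof.
have lin : is_derive c (1 : R) (fun s : R => b * s) b.
  have H := is_deriveZ b (is_derive_id c (1 : R)).
  by apply: (is_derive_eq H); rewrite -[_ *: _]/(_ * _) mulr1.
have := is_derive1_comp (f := expR) (is_derive_expR (b * c)) lin.
by move=> H; apply: (is_derive_eq H); rewrite -?[_ *: _]/(_ * _) mulrC.
Qed.

(** * The Cauchy-Lipschitz theorem for a globally Lipschitz field *)

Section Picard.
Context {R : realType}.
Notation mu := (@lebesgue_measure R).

Lemma row_continuous m (f : 'I_m -> R -> R) : (forall i, continuous (f i)) ->
  continuous (fun t => \row_i f i t).
Proof.
move=> cf; have -> : (fun t => \row_i f i t) =
    (fun t => \sum_i f i t *: delta_mx 0 i) :> (R -> 'rV[R]_m).
  apply/funext => s; rewrite [LHS]row_sum_delta; apply: eq_bigr => i _.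
  by rewrite mxE.
move=> t; apply: (@cvg_big _ _ _ _ _ add_continuous _ (nbhs t)) => i _.
by apply: (cvgZr_tmp (F := nbhs t)); exact: cf.
Qed.

(** The primitives are required to have derivative [g] on ]-1, 1[ only, where
    an integral with lower bound -1 provides one on both sides of 0. *)
Definition primitive_of (g G : R -> R) : Prop :=
  G 0 = 0 /\ forall t : R, -1 < t < 1 -> is_derive t (1 : R) G (g t).

Lemma primitive_exists (g : R -> R) : continuous g -> exists G, primitive_of g G.
Proof.
move=> cg; pose F (x : R) : R := (\int[mu]_(t in [set` `[-1, x]]) (g t))%R.
exists (fun x => F x - F 0); split; first by rewrite subrr.
move=> t /andP[t0 t1].
have [] := @continuous_FTC1_closed R g (-1) t 1 t1 _ t0 (cg t).
  apply: continuous_compact_integrable; first exact: segment_compact.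
  exact: continuous_subspaceT.
rewrite -/F derive1E => dF FE.
have /is_derive_cvgP H : is_derive t (1 : R) F (g t) by split.
apply/is_derive_cvgP; rewrite [X in X @ _ --> _](_ : _ =
   (fun h : R => h^-1 *: (F (h *: 1 + t) - F t))) //.
by apply/funext => h; rewrite opprB addrA subrK.
Qed.

Definition primitive (g : R -> R) : R -> R := get (primitive_of g).

Lemma primitiveP g : continuous g -> primitive_of g (primitive g).
Proof. by move=> /primitive_exists h; apply: getPex. Qed.

(** The sequences [x k - r k] and [x k + r k], with [r k = 2 B / 2 ^ k], are
    monotone in opposite directions and enclose the limit. *)
Lemma geometric_limit (x : nat -> R) (B : R) :
  (forall k, `|x k.+1 - x k| <= B / 2 ^+ k) ->
  exists l, forall k, `|x k - l| <= B / 2 ^+ k * 2.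
Proof.
move=> xB; pose r k := B / 2 ^+ k * 2.
have rS k : r k - r k.+1 = B / 2 ^+ k.
  by rewrite /r exprS invfM; field; rewrite expf_neq0.
have r0 k : 0 <= r k by rewrite /r mulr_ge0 // (le_trans _ (xB k)).
have inc : {homo (fun k => x k - r k) : m n / (m <= n)%N >-> m <= n}.
  apply: homo_leq => [a|b a c ab bc|k]; [exact: lexx|exact: le_trans ab bc|].
  by have := xB k; rewrite ler_norml -rS => /andP[h _]; lra.
have dec : {homo (fun k => x k + r k) : m n / (m <= n)%N >-> n <= m}.
  apply: homo_leq => [a|b a c ab bc|k]; [exact: lexx|exact: le_trans bc ab|].
  by have := xB k; rewrite ler_norml -rS => /andP[_ h]; lra.
have cross j k : x j - r j <= x k + r k.
  apply: le_trans (inc j (maxn j k) (leq_maxl _ _)) _.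
  apply: le_trans (dec k (maxn j k) (leq_maxr _ _)).
  have := r0 (maxn j k); lra.
have A0 : range (fun k => x k - r k) !=set0 by exists (x 0%N - r 0%N), 0%N.
exists (sup (range (fun k => x k - r k))) => k; rewrite ler_norml.
have lo : x k - r k <= sup (range (fun k => x k - r k)).
  apply: ub_le_sup; last by exists k.
  by exists (x 0%N + r 0%N) => _ [j _ <-].
have hi : sup (range (fun k => x k - r k)) <= x k + r k.
  by apply: ge_sup => // _ [j _ <-].
by rewrite -/(r k); apply/andP; split; lra.
Qed.

Context {n : nat}.
Variables (psi : 'rV[R]_n -> 'rV[R]_n) (K : R) (a0 : 'rV[R]_n).
Hypotheses (K0 : 0 <= K) (psiK : forall a b, `|psi a - psi b| <= K * `|a - b|).

(* On [-h, h] the Picard operator contracts by [h * K <= 1 / 2]. *)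
Let h : R := (2 * (K + 1))^-1.

Let h0 : 0 < h.
Proof. by rewrite invr_gt0; have := K0; lra. Qed.

Let h1 : h < 1.
Proof. by rewrite invf_lt1; have := K0; lra. Qed.

Let hK : h * K <= 2^-1.
Proof.
rewrite /h invfM -mulrA -[leRHS]mulr1 ler_pM2l ?invr_gt0 //.
by rewrite mulrC ler_pdivrMr; have := K0; lra.
Qed.

(* Composing with [clamp] turns curves on [-h, h] into curves on the whole
   line, so that continuity and uniform bounds need no restriction of the
   domain. *)
Let clamp (t : R) : R := Num.max (- h) (Num.min t h).

Let clamp_id t : - h <= t <= h -> clamp t = t.
Proof. by move=> /andP[ht th]; rewrite /clamp min_l // max_r. Qed.

Let clamp_bound t : - h <= clamp t <= h.
Proof. by rewrite /clamp le_max lexx ge_max ge_min lexx orbT andbT; have := h0;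
  lra. Qed.

Let clamp_continuous : continuous clamp.
Proof.
move=> t; apply: (@continuous_max R R (cst (- h)) (fun t => Num.min t h) t);
  first exact: cst_continuous.
by apply: (@continuous_min R R id (cst h) t);
  [exact: cvg_id|exact: cst_continuous].
Qed.

Let inner t : - h <= t <= h -> -1 < t < 1.
Proof. by have := h1; have := h0 => ? ? /andP[? ?]; apply/andP; split; lra. Qed.

Let psi_continuous : continuous psi.
Proof.
move=> a; apply/(cvgrPdist_lt (F := nbhs a)) => eps eps0.
have K1 : 0 < K + 1 by have := K0; lra.
have e0 : 0 < eps / (K + 1) by exact: divr_gt0.
apply: filterS (nbhsx_ballx a _ e0) => b; rewrite -ball_normE /= => ab.
apply: le_lt_trans (psiK _ _) _; apply: (@le_lt_trans _ _ ((K + 1) * `|a - b|)).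
  by apply: ler_wpM2r => //; lra.
by rewrite mulrC -ltr_pdivlMr.
Qed.

Let prim (u : R -> 'rV[R]_n) (i : 'I_n) : R -> R :=
  primitive (fun s => psi (u s) 0 i).

Let picard (u : R -> 'rV[R]_n) : R -> 'rV[R]_n :=
  fun t => a0 + \row_i prim u i (clamp t).

Let field_continuous (u : R -> 'rV[R]_n) i : continuous u -> continuous (fun s => psi (u s) 0 i).
Proof.
move=> cu s; apply: (@continuous_comp _ _ _ u (fun a => psi a 0 i));
  first exact: cu.
apply: (@continuous_comp _ _ _ psi (fun a : 'rV[R]_n => a 0 i)).
  exact: psi_continuous.
exact: coord_continuous.
Qed.

Let primP (u : R -> 'rV[R]_n) i : continuous u ->
  primitive_of (fun s => psi (u s) 0 i) (prim u i).
Proof. by move=> cu; apply/primitiveP/field_continuous. Qed.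

Let picard_continuous (u : R -> 'rV[R]_n) : continuous u -> continuous (picard u).
Proof.
move=> cu t; apply: (cvgD (F := nbhs t)); first exact: cvg_cst.
apply: (@row_continuous n (fun i t => prim u i (clamp t))) => i {}t.
apply: (@continuous_comp _ _ _ clamp (prim u i)); first exact: clamp_continuous.
apply: differentiable_continuous; apply/derivable1_diffP.
exact: (@ex_derive _ _ _ _ _ _ _ ((primP i cu).2 _ (inner (clamp_bound t)))).
Qed.

Let picard_contract (u v : R -> 'rV[R]_n) D : continuous u -> continuous v -> 0 <= D ->
  (forall t, `|u t - v t| <= D) ->
  forall t, `|picard u t - picard v t| <= 2^-1 * D.
Proof.
move=> cu cv D0 uvD t; rewrite /picard opprD addrACA subrr add0r.
apply: norm_rV_le => [|i]; first by rewrite mulr_ge0.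
rewrite !mxE; set c := clamp t.
have cI := inner (clamp_bound t); rewrite -/c in cI.
have [u0 du] := primP i cu; have [v0 dv] := primP i cv.
have dF (s : R) : -1 < s < 1 -> is_derive s (1 : R) (prim u i - prim v i)
    (psi (u s) 0 i - psi (v s) 0 i).
  by move=> sI; apply: is_deriveB; [exact: du|exact: dv].
have := @mean_value_bound R _ _ 1 (K * D) ltr01 (mulr_ge0 K0 D0) dF _ c cI.
rewrite /= !fctE u0 v0 subrr subr0 => H.
apply: le_trans (H _) _.
  move=> s sI; have := norm_coord_le (psi (u s) - psi (v s)) i.
  rewrite !mxE => /le_trans; apply; apply: le_trans (psiK _ _) _.
  exact: ler_wpM2l.
have ch : `|c| <= h by rewrite ler_norml; exact: clamp_bound.
apply: (@le_trans _ _ (K * D * h)).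
  by apply: ler_wpM2l => //; exact: mulr_ge0.
by rewrite -mulrA mulrCA mulrC (mulrC K) ; apply: ler_wpM2r.
Qed.

Let iterate k : R -> 'rV[R]_n := iter k picard (cst a0).

Let iterate_continuous k : continuous (iterate k).
Proof. by elim: k => [|k]; [exact: cst_continuous|exact: picard_continuous]. Qed.

Let B : R := `|psi a0|.

Let iterate_step k t : `|iterate k.+1 t - iterate k t| <= B / 2 ^+ k.
Proof.
elim: k t => [|k IH] t.
  rewrite /= /picard addrAC subrr add0r expr0 divr1.
  apply: norm_rV_le => [|i]; [exact: normr_ge0|rewrite mxE].
  have [G0 dG] := @primP (cst a0) i (@cst_continuous _ _ _).
  have := @mean_value_bound R _ _ 1 B ltr01 (normr_ge0 _) dG _ _ (inner (clamp_bound t)).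
  rewrite G0 subr0 => H; apply: le_trans (H _) _.
    by move=> s _; exact: norm_coord_le.
  rewrite -[leRHS]mulr1; apply: ler_wpM2l; first exact: normr_ge0.
  apply: (@le_trans _ _ h); first by rewrite ler_norml; exact: clamp_bound.
  exact: ltW.
rewrite exprS invfM mulrCA; apply: picard_contract IH t;
  [exact: iterate_continuous..|].
by rewrite divr_ge0 // /B.
Qed.

(** The iterates form a uniform Cauchy sequence with geometric rate; their limit
    is continuous and is a fixed point of the Picard operator. *)
Lemma picard_lindelof : exists (d : R) (u : R -> 'rV[R]_n), [/\ 0 < d, u 0 = a0,
  continuous u & forall t, - d < t < d -> is_derive t (1 : R) u (psi (u t))].
Proof.
have lim_ex t i : exists l, forall k, `|iterate k t 0 i - l| <= B / 2 ^+ k * 2.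
  apply: geometric_limit => k; apply: le_trans (iterate_step k t).
  by have := norm_coord_le (iterate k.+1 t - iterate k t) i; rewrite !mxE.
pose u t : 'rV[R]_n := \row_i sval (cid (lim_ex t i)).
pose r k : R := B / 2 ^+ k * 2.
have r0 k : 0 <= r k by rewrite /r mulr_ge0 // divr_ge0 // /B.
have rS k : r k.+1 = 2^-1 * r k.
  by rewrite /r exprS invfM; ring.
have ur k t : `|iterate k t - u t| <= r k.
  by apply: norm_rV_le => // i; rewrite !mxE; exact: (svalP (cid (lim_ex t i))).
have r_small eps : 0 < eps -> exists k, r k < eps.
  move=> eps0; have cr : r k @[k --> \oo] --> 0.
    have -> : r = (fun k => (B * 2) * 2^-1 ^+ k).
      by apply/funext => k; rewrite /r exprVn; ring.
    rewrite -[X in _ --> X](mulr0 (B * 2)).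
    by apply: cvgM; [exact: cvg_cst|apply: cvg_expr; rewrite ger0_norm // invf_lt1 // ltr1n].
  have /cvgrPdist_lt/(_ _ eps0)[k _ kP] := cr.
  exists k; have := kP k (leqnn k); rewrite /= sub0r normrN ger0_norm //.
have cu : continuous u.
  move=> t; apply/cvgrPdist_lt => eps eps0.
  have e3 : 0 < eps / 3 by rewrite divr_gt0.
  have [k rk] := r_small _ e3; near=> s.
  have := ur k t; have := ur k s => us ut.
  have ts : `|iterate k t - iterate k s| < eps / 3.
    near: s; apply: (@cvgr_dist_lt _ _ _ (nbhs t)) => //.
    exact: iterate_continuous.
  rewrite -(subrKA (iterate k t)) -(subrKA (iterate k s) (iterate k t)).
  apply: le_lt_trans (ler_normD _ _) _; rewrite distrC.
  apply: le_lt_trans (lerD (lexx _) (ler_normD _ _)) _; lra.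
have fixu t : picard u t = u t.
  apply/eqP; rewrite -subr_eq0 -normr_le0; apply/ler_addgt0Pl => eps eps0.
  rewrite addr0; have e2 : 0 < eps / 2 by rewrite divr_gt0.
  have [k rk] := r_small _ e2.
  rewrite -(subrKA (iterate k.+1 t)); apply: le_trans (ler_normD _ _) _.
  have := ur k.+1 t; rewrite rS => H1.
  have := @picard_contract u (iterate k) (r k) cu (@iterate_continuous k) (r0 k) _ t.
  move=> H2; have {}H2 : `|picard u t - iterate k.+1 t| <= 2^-1 * r k.
    by apply: H2 => s; rewrite distrC.
  have := lerD H2 H1; lra.
exists h, u; split=> //.
  rewrite -fixu /picard clamp_id; last by have := h0; lra.
  apply/rowP => i; rewrite !mxE; have [-> _] := primP i cu.
  by rewrite addr0.
move=> t /andP[t0 t1].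
have dpic : is_derive t (1 : R) (fun s => a0 + \row_i prim u i s) (psi (u t)).
  have tI : -1 < t < 1 by apply: inner; rewrite !ltW.
  have di i : is_derive t (1 : R) (prim u i) (psi (u t) 0 i) by exact: (primP i cu).2.
  have dM : derivable (fun s => a0 + \row_i prim u i s) t (1 : R).
    apply/derivable_mxP => i j; rewrite ord1.
    rewrite (_ : (fun s => _) = (cst (a0 0 j) + prim u j)); last first.
      by apply/funext => s; rewrite !mxE.
    apply: derivableD; first exact: derivable_cst.
    exact: (@ex_derive _ _ _ _ _ _ _ (di j)).
  split=> //; rewrite derive_mx //; apply/rowP => j; rewrite mxE.
  rewrite (_ : (fun s => _) = (cst (a0 0 j) + prim u j)); last first.
    by apply/funext => s; rewrite !mxE.
  have dj := is_deriveD (is_derive_cst (a0 0 j) t 1) (di j).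
  by rewrite derive_val add0r.
have tI : t \in `](- h), h[ by rewrite in_itv /= t0 t1.
apply: near_eq_is_derive dpic; apply: filterS (near_in_itvoo tI) => s.
rewrite in_itv /= => /andP[s0 s1].
by rewrite -[RHS]fixu /picard clamp_id // !ltW.
Unshelve. all: by end_near. Qed.

End Picard.

(** * Maximal solutions of a continuously differentiable field *)

Section MaximalSolutions.
Context {R : realType} {X : finDimNormedModType R}.
Variable phi : X -> X.
Hypothesis phi_C1 : continuously_differentiable phi.

(** Lipschitz continuity is stated through functionals, with the bound [m] of
    the functional as a factor: in this form it follows from the mean value
    theorem, and it applies to the coordinates of [phi]. *)
Lemma locally_lipschitz x0 : exists r k : R, [/\ 0 < r, 0 <= k &
  forall (l : {linear X -> R^o}) (m : R), 0 <= m ->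
    (forall w, `|l w : R| <= m * `|w|) ->
    forall y z, `|y - x0| < r -> `|z - x0| < r ->
    `|l (phi y - phi z) : R| <= m * k * `|y - z|].
Proof.
have [df cdf] := phi_C1.
have [k k0 kP] := linear_lipschitz (@findim_linear_continuous R X X ('d phi x0)).
have /nbhs_ballP[r /= r0 rP] := cdf x0 1 ltr01.
exists r, (k + 1); split=> //; first by rewrite addr_ge0 // ltW.
move=> l m m0 lm y z yr zr.
have := @mean_value_functional R _ _ l phi z (y - z)
  (@findim_linear_continuous _ _ _ l) df.
move=> [s /andP[s0 s1]]; rewrite subrKC => E.
have -> : l (phi y - phi z) = l (phi y) - l (phi z) :> R by exact: linearB.
rewrite E.
set w := z + s *: (y - z).
have wr : ball x0 r w.
  rewrite -ball_normE /= distrC.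
  have -> : w - x0 = s *: (y - x0) + (1 - s) *: (z - x0).
    have yz : y - z = (y - x0) - (z - x0) by rewrite opprB addrA subrK.
    by rewrite /w yz (addrAC z) scalerBr scalerBl scale1r addrCA.
  apply: le_lt_trans (ler_normD _ _) _; rewrite !normrZ (gtr0_norm s0).
  rewrite gtr0_norm ?subr_gt0 //; nra.
apply: le_trans (lm _) _; rewrite -mulrA; apply: ler_wpM2l => //.
have := rP _ wr (y - z); rewrite mul1r => H.
rewrite -[X in `|X|](subrK ('d phi x0 (y - z)));
  apply: le_trans (ler_normD _ _) _.
rewrite mulrDl mul1r addrC; exact: lerD.
Qed.

(* Truncation to the interval [c - r, c + r]. It is used on each coordinate to extend a
   field from a box to a globally Lipschitz field. *)
Let cut (c r t : R) : R := Num.max (c - r) (Num.min t (c + r)).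

Let cut_lipschitz c r s t : 0 <= r -> `|cut c r s - cut c r t| <= `|s - t|.
Proof.
move=> r0; rewrite /cut ler_norml; have := ler_norm (s - t);
  have := ler_norm (t - s).
rewrite distrC => h1 h2.
by case: (leP s (c + r)) => h3; case: (leP t (c + r)) => h4;
  rewrite ?(max_r (_ : c - r <= c + r)); try lra;
  try (case: (leP (c - r) s) => h5); try (case: (leP (c - r) t) => h6);
  apply/andP; split; lra.
Qed.

Let cut_id c r t : `|t - c| <= r -> cut c r t = t.
Proof.
by rewrite ler_norml => /andP[h1 h2]; rewrite /cut min_l ?max_r //; lra.
Qed.

Let cut_near c r t : 0 <= r -> `|cut c r t - c| <= r.
Proof.
move=> r0; have lo : c - r <= cut c r t by rewrite /cut le_max lexx.
have hi : cut c r t <= c + r.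
  by rewrite /cut ge_max ge_min lexx orbT andbT; lra.
by rewrite ler_norml; apply/andP; split; lra.
Qed.

(** The field read in coordinates and frozen outside a small box is globally
    Lipschitz, and its solution stays in the box, where the fields agree, for a
    short time. *)
Lemma local_solution x0 : exists J u, is_solution phi x0 J u.
Proof.
have [r [k [r0 k0 lip]]] := locally_lipschitz x0.
have [m m0 mP] := linear_lipschitz (@r2v_continuous R X).
have [q q0 qP] := @v2r_lipschitz R X.
pose a0 := v2r x0; pose rho := r / (2 * m).
have rho0 : 0 < rho by rewrite divr_gt0 // mulr_gt0.
pose box (a : 'rV[R]_(dim X)) : 'rV[R]_(dim X) := \row_i cut (a0 0 i) rho (a 0 i).
have box_near a : `|r2v (box a) - x0| < r.
  rewrite -(v2rK x0) -linearB; apply: le_lt_trans (mP _) _.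
  apply: (@le_lt_trans _ _ (m * rho)); last first.
    have -> : m * rho = r / 2 by rewrite /rho; field; rewrite gt_eqF.
    lra.
  rewrite ler_pM2l //; apply: norm_rV_le => [|i]; first exact: ltW.
  by rewrite !mxE; apply: cut_near; exact: ltW.
have box_lip a b : `|box a - box b| <= `|a - b|.
  apply: norm_rV_le => // i; rewrite !mxE;
    apply: le_trans (cut_lipschitz _ _ _ _) _.
    exact: ltW.
  by have := norm_coord_le (a - b) i; rewrite !mxE.
pose psi a := v2r (phi (r2v (box a))).
have coord_lin i : linear (fun x : X => v2r x 0 i : R^o).
  by move=> c x y; rewrite linearP !mxE.
have psi_lip a b : `|psi a - psi b| <= q * k * m * `|a - b|.
  apply: norm_rV_le => [|i]; first by rewrite !mulr_ge0 // ltW.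
  pose lL := GRing.isLinear.Build _ _ _ _ _ (coord_lin i).
  pose l : {linear X -> R^o} := HB.pack (fun x : X => v2r x 0 i : R^o) lL.
  have lq w : `|l w : R| <= q * `|w|.
    by apply: le_trans (qP w); exact: norm_coord_le.
  have := lip l q (ltW q0) lq _ _ (box_near a) (box_near b).
  rewrite /= linearB /= => /le_trans; apply.
  rewrite -linearB -[leRHS]mulrA; apply: ler_wpM2l.
    by rewrite mulr_ge0 // ltW.
  by apply: le_trans (mP _) _; rewrite ler_pM2l.
have qkm : 0 <= q * k * m by rewrite !mulr_ge0 // ltW.
have [d [u [d0 u0 cu du]]] := picard_lindelof a0 qkm psi_lip.
have /cvgrPdist_lt/(_ _ rho0) := cu 0.
move=> /nbhs_ballP[d1 /= d10 dP].
pose d2 := Num.min d d1.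
have d20 : 0 < d2 by rewrite lt_min d0 d10.
exists [set` `](- d2), d2[%R], (r2v \o u); split.
- exact: interval_open.
- exact: interval_is_interval.
- by rewrite /= in_itv /= oppr_lt0 d20.
- by rewrite /= u0 v2rK.
- move=> t; rewrite /= in_itv /= => /andP[t0 t1].
  have td : - d < t < d.
    have : d2 <= d by rewrite ge_min lexx.
    by move=> ?; apply/andP; split; lra.
  have boxE : box (u t) = u t.
    apply/rowP => i; rewrite mxE; apply: cut_id.
    have := dP t; rewrite u0 -ball_normE /= sub0r normrN => H.
    have {}H : `|a0 - u t| < rho.
      apply: H; have : d2 <= d1 by rewrite ge_min lexx orbT.
      by rewrite ltr_norml => ?; apply/andP; split; lra.
    have := norm_coord_le (u t - a0) i; rewrite !mxE => /le_trans; apply.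
    by rewrite distrC ltW.
  have -> : phi (r2v (u t)) = r2v (psi (u t)) by rewrite /psi v2rK boxE.
  apply: is_derive_linear; first exact: r2v_continuous.
  exact: du.
Qed.

(** Zorn's lemma for the preorder of extension of solutions. The solutions of a
    chain agree where they are defined and glue to a solution on the union of
    their intervals. A premaximal element suffices, as maximality of a solution
    concerns its interval only. *)
Lemma maximal_solution_exists x0 : exists J u, is_maximal_solution phi x0 J u.
Proof.
pose T := {p : set R * (R -> X) | is_solution phi x0 p.1 p.2}.
pose ext (p q : T) : Prop := (sval p).1 `<=` (sval q).1 /\
  forall t, (sval p).1 t -> (sval q).2 t = (sval p).2 t.
have [J0 [u0 sol0]] := local_solution x0.
pose p0 : T := exist _ (J0, u0) sol0.
have [||A Atot|[[J u] sol] premax] := ZL_preorder p0 (R := fun p q => `[< ext p q >]).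
- by move=> p; apply/asboolP; split.
- move=> p q s /asboolP[pq1 pq2] /asboolP[qs1 qs2]; apply/asboolP; split.
    exact: subset_trans qs1.
  by move=> t pt; rewrite qs2 ?pq2 //; exact: pq1.
- have [[p Ap]|A0] := pselect (A !=set0); last first.
    by exists p0 => s As; exfalso; apply: A0; exists s.
  pose J := \bigcup_(s in A) (sval s).1.
  pose s_ t := if pselect (exists s, A s /\ (sval s).1 t) is left ex then
    sval (cid ex) else p.
  pose u t := (sval (s_ t)).2 t.
  have uE s t : A s -> (sval s).1 t -> u t = (sval s).2 t.
    move=> As st; have [] : A (s_ t) /\ (sval (s_ t)).1 t.
      by rewrite /s_; case: pselect => [ex|[]]; [exact: svalP (cid ex)|exists s].
    move=> As' st'; have [/asboolP[_ h]|/asboolP[_ h]] := Atot _ _ As As'.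
      by rewrite /u h.
    by rewrite h.
  have sol : is_solution phi x0 J u.
    split.
    - by apply: bigcup_open => s _; have [] := svalP s.
    - move=> x y [s As sx] [s' As' sy] z xzy.
      have [/asboolP[h _]|/asboolP[h _]] := Atot _ _ As As'.
        by exists s' => //; have [_ + _ _ _] := svalP s'; apply;
          [apply: h sx|exact: sy|].
      by exists s => //; have [_ + _ _ _] := svalP s; apply;
        [exact: sx|apply: h sy|].
    - by exists p => //; have [] := svalP p.
    - by have [_ _ J0p pE _] := svalP p; rewrite (uE p).
    - move=> t [s As st]; rewrite (uE s) //.
      have [oJ _ _ _ dJ] := svalP s.
      apply: near_eq_is_derive (dJ t st).
      by apply: filterS (open_nbhs_nbhs (conj oJ st)) => t' st'; rewrite (uE s).
  exists (exist _ (J, u) sol) => s As; apply/asboolP; split=> /=.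
    by move=> t st; exists s.
  by move=> t st; rewrite (uE s).
exists J, u; split=> // J' v solv JJ' vu.
have /asboolP[+ _] := premax (exist _ (J', v) solv) (asboolT (conj JJ' vu)).
by move=> /= J'J; apply/seteqP; split.
Qed.

Lemma flow_is_solution x0 : is_solution phi x0 (flow_domain phi x0) (fun t => flow phi t x0).
Proof.
have [J [u Ju]] := maximal_solution_exists x0.
have : [set Ju | is_maximal_solution phi x0 Ju.1 Ju.2] (maximal_solution phi x0).
  by apply: getPex; exists (J, u).
by case.
Qed.

End MaximalSolutions.

(** * The contraction rate of the flow *)

Section ContractionRate.
Context {R : realType} {X : finDimNormedModType R}.
Variables (C : set X) (e : X) (phi : X -> X) (U : set X).
Hypotheses (C_closed : closed C) (C_cone : convex_cone C).
Hypotheses (C_pointed : pointed_cone C) (e_int : interior C e).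
Hypotheses (phi_C1 : continuously_differentiable phi).
Hypothesis phi_inv : forall (lambda : R) (x : X), phi (x + lambda *: e) = phi x.

Let lin_cont (W : normedModType R) (l : {linear X -> W}) : continuous l.
Proof. exact: findim_linear_continuous. Qed.

Let is_derive_functional (mu : 'Hom(X, R^o)) (f : R -> X) (x : R) d :
  is_derive x (1 : R) f d -> is_derive x (1 : R) (fun t => mu (f t) : R) (mu d : R).
Proof.
by move=> df; apply: (is_derive_linear (l := GRing.Linear.clone _ _ _ _ mu _)) df; exact: lin_cont.
Qed.

Let mean_value (mu : 'Hom(X, R^o)) y z : exists2 s : R, 0 < s < 1 &
  mu (phi (y + z)) - mu (phi y) = mu ('d phi (y + s *: z) z) :> R.
Proof.
apply: (mean_value_functional (l := GRing.Linear.clone _ _ _ _ mu _)).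
  exact: lin_cont.
exact: phi_C1.1.
Qed.

(** [phi] is constant in the direction [e]. *)
Lemma diff_unit0 x : 'd phi x e = 0.
Proof.
have df := phi_C1.1 (x + 0 *: e); have := is_derive_line df.
have -> : (fun r : R => phi (x + r *: e)) = cst (phi x).
  by apply/funext => r; rewrite phi_inv.
move=> H; have := @derive_val _ _ _ _ _ _ _ H.
by rewrite derive_cst scale0r addr0.
Qed.

Lemma before_exit_time x t s : 0 <= s <= t -> (t%:E < exit_time phi U x)%E ->
  flow_domain phi x s /\ U (flow phi s x).
Proof.
move=> /andP[s0 st] /ereal_sup_gt[_ [t0 [Jt0 _ Ut0] <-]]; rewrite lte_fin => tt0.
have [_ Jint J0 _ _] := flow_is_solution phi_C1 x; split.
  by apply: (Jint 0 t0) => //; rewrite s0 (le_trans st) // ltW.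
by apply: Ut0 => //; exact: le_lt_trans tt0.
Qed.

Lemma exit_time_pos x : open U -> U x ->
  exists2 d : R, 0 < d & forall t, t < d -> (t%:E < exit_time phi U x)%E.
Proof.
move=> U_open Ux; have [Jopen _ J0 f0 df] := flow_is_solution phi_C1 x.
have cf : {for 0, continuous (fun t => flow phi t x)}.
  apply: differentiable_continuous; apply/derivable1_diffP.
  exact: (@ex_derive _ _ _ _ _ _ _ (df 0 J0)).
have nU : \forall t \near (0 : R), U (flow phi t x).
  by apply: cf; apply: open_nbhs_nbhs; split => //; rewrite f0.
have nJ : nbhs (0 : R) (flow_domain phi x) by apply: open_nbhs_nbhs.
have /nbhs_ballP[r /= r0 rP] :
    nbhs (0 : R) ([set t | U (flow phi t x)] `&` flow_domain phi x).
  exact: filterI.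
have inr t : 0 <= t -> t < r -> ball (0 : R) r t.
  by move=> t0 tr; rewrite -ball_normE /= sub0r normrN ger0_norm.
exists (r / 2) => [|t tr]; first by rewrite divr_gt0.
apply: (@lt_le_trans _ _ ((r / 2)%:E)); first by rewrite lte_fin.
apply: ereal_sup_ubound; exists (r / 2) => //; split.
- by apply: (rP _ (inr _ _ _)).2; [rewrite divr_ge0 // ltW|lra].
- by rewrite divr_ge0 // ltW.
- by move=> s s0 sr; apply: (rP _ (inr _ s0 _)).1; lra.
Qed.

(** The two differentiations are one-sided: in time, because the contraction
    estimate holds for [t >= 0], and in the size of the perturbation
    [eps *: v], because Hopf's seminorm of [eps *: v] is at most [eps] for
    [eps >= 0] and [0 <= v <= e]. *)
Lemma contraction_rate_ge (b : R) : open U ->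
  (forall (x y : X) (t : R), U x -> U y -> 0 <= t ->
     (t%:E < Order.min (exit_time phi U x) (exit_time phi U y))%E ->
     (hopf_seminorm C e (flow phi t x - flow phi t y)%R
        <= (expR (b * t))%:E * hopf_seminorm C e (x - y)%R)%E) ->
  forall x, U x -> (hopf_h C e ('d phi x) <= b%:E)%E.
Proof.
move=> U_open Hb x Ux; apply: hopf_h_le => // [|pi nu v piS nuS Cv Cev nuv piv].
  exact: diff_unit0.
pose l : 'Hom(X, R^o) := pi - nu.
have lE w : l w = pi w - nu w :> R by rewrite /l add_lfunE opp_lfunE.
have lv : l v = 1 :> R by rewrite lE piv nuv subr0.
have first_order (eps : R) : 0 < eps -> U (x + eps *: v) ->
    l (phi (x + eps *: v) - phi x) <= b * eps :> R.
  move=> eps0; set y := x + eps *: v => Uy.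
  have [d d0 dP] := exit_time_pos U_open Ux;
    have [d' d'0 d'P] := exit_time_pos U_open Uy.
  have [_ _ Jx0 fx0 dfx] := flow_is_solution phi_C1 x.
  have [_ _ Jy0 fy0 dfy] := flow_is_solution phi_C1 y.
  have dz : is_derive (0 : R) (1 : R) (fun t => flow phi t y - flow phi t x)
      (phi y - phi x).
    have := is_deriveB (dfy 0 Jy0) (dfx 0 Jx0).
    by rewrite fx0 fy0.
  have dg : is_derive (0 : R) (1 : R)
      (fun t => l (flow phi t y - flow phi t x) - eps * expR (b * t) : R)
      (l (phi y - phi x) - eps * (b * expR (b * 0)) : R).
    have dl := is_derive_functional l dz.
    exact: (is_deriveB dl (is_deriveZ eps (is_derive_expRM b 0))).
  suff : l (phi y - phi x) - eps * (b * expR (b * 0)) <= 0 :> R.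
    by rewrite mulr0 expR0 mulr1 subr_le0 mulrC.
  have yx : y - x = eps *: v by rewrite /y addrC addKr.
  have lyx : l (y - x) = eps :> R.
    by rewrite yx [LHS]linearZ -[LHS]/(eps * l v) lv mulr1.
  apply: (derive_right_max dg); near=> t.
  rewrite addr0 mulr0 expR0 mulr1 fx0 fy0 lyx subrr subr_le0 -lee_fin EFinM lE.
  have t0 : 0 < t by near: t; exact: nbhs_right_gt.
  apply: le_trans (hopf_ge _ piS nuS) _.
  apply: le_trans (Hb y x t Uy Ux (ltW t0) _) _.
    rewrite lt_min d'P ?dP //; near: t; exact: nbhs_right_lt.
  rewrite muleC yx; apply: lee_wpmul2r; first by rewrite lee_fin expR_ge0.
  have := @hopf_le _ _ C e (eps *: v) eps 0;
    rewrite subr0 scale0r subr0 -scalerBr.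
  by apply; apply: C_cone.2 => //; exact: ltW.
have dG : is_derive (0 : R) (1 : R) (fun s : R => l (phi (x + s *: v)) - b * s : R)
    (l ('d phi x v) - b : R).
  have df := is_derive_line (phi_C1.1 (x + 0 *: v)).
  have dl := is_derive_functional l df.
  have H := is_deriveB dl (is_deriveZ b (is_derive_id (0 : R) (1 : R))).
  by apply: (is_derive_eq H); rewrite scale0r addr0 -[_ *: _]/(_ * _ : R) mulr1.
rewrite -lE -subr_le0; apply: (derive_right_max dG).
have nU : \forall s \near 0^'+, U (x + s *: v).
  have cf : (fun s : R => x + s *: v) @ (0 : R) --> x + 0 *: v.
    by apply: cvgD; [exact: cvg_cst|apply: cvgZr_tmp; exact: cvg_id].
  apply: (cvg_at_right_filter cf); apply: open_nbhs_nbhs; split=> //.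
  by rewrite scale0r addr0.
near=> s; rewrite addr0 scale0r addr0 mulr0 subr0 lerBlDl -lerBlDr.
have s0 : 0 < s by near: s; exact: nbhs_right_gt.
have -> : l (phi (x + s *: v)) - l (phi x) = l (phi (x + s *: v) - phi x) :> R.
  by rewrite linearB.
by apply: first_order => //; near: s.
Unshelve. all: by end_near. Qed.

(** A Gronwall argument for a function that is only a maximum of differentiable
    ones. The derivative from the left at a maximum point suffices; there a
    single pair [pi], [nu], optimal at that time, bounds the seminorm from below
    at the earlier times. *)
Lemma contraction_rate_le (b : R) :
  convex_set (U : set (convex_lmodType X)) ->
  (forall x, U x -> (hopf_h C e ('d phi x) <= b%:E)%E) ->
  forall (x y : X) (t : R), U x -> U y -> 0 <= t ->
    (t%:E < Order.min (exit_time phi U x) (exit_time phi U y))%E ->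
    (hopf_seminorm C e (flow phi t x - flow phi t y)%R
       <= (expR (b * t))%:E * hopf_seminorm C e (x - y)%R)%E.
Proof.
move=> U_convex hb x y T Ux Uy T0; rewrite lt_min => /andP[Tx Ty].
have [e0|e0] := eqVneq e 0; first by rewrite hopf_unit0 // leNye.
have U_segment p q s : U p -> U q -> 0 < s < 1 -> U (q + s *: (p - q)).
  move=> Up Uq /andP[s0 s1].
  have s01 : (0 <= s <= 1) by rewrite !ltW.
  have := U_convex p q (Itv01 (ltW s0) (ltW s1)).
  rewrite !inE => /(_ Up Uq) H.
  have -> : q + s *: (p - q) = s *: p + (1 - s) *: q.
    by rewrite scalerBr scalerBl scale1r addrCA.
  exact: H.
pose N (w : X) : R := fine (hopf_seminorm C e w).
have NE w : hopf_seminorm C e w = (N w)%:E.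
  have [pi [nu [_ _ E]]] := hopf_attained C_closed C_cone C_pointed e_int w e0.
  by rewrite /N E.
have N_ge pi nu w : simplex C e pi -> simplex C e nu -> pi w - nu w <= N w :> R.
  by move=> piS nuS; rewrite -lee_fin -NE; exact: hopf_ge.
have [k k0 kP] := simplex_bounded e_int.
have N_lip w w' : N w <= N w' + (k + k) * `|w' - w|.
  have [pi [nu [piS nuS]]] := hopf_attained C_closed C_cone C_pointed e_int w e0.
  rewrite NE => -[->]; have := N_ge pi nu w' piS nuS.
  have := kP pi (w' - w) piS; have := kP nu (w' - w) nuS.
  rewrite !linearB /= !ler_norml => /andP[h1 h2] /andP[h3 h4] h5; lra.
have N_cont : continuous N.
  move=> w; apply/(cvgrPdist_lt (F := nbhs w)) => eps eps0.
  have kk : 0 < k + k by lra.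
  apply: filterS (nbhsx_ballx w _ (divr_gt0 eps0 kk)) => w'.
  rewrite -ball_normE /= ltr_pdivlMr // mulrC => h.
  have := N_lip w w'; have := N_lip w' w; rewrite (distrC w') => h1 h2.
  by rewrite ltr_norml; apply/andP; split; lra.
have solx s : 0 <= s <= T -> is_derive s (1 : R) (fun t => flow phi t x) (phi (flow phi s x)).
  move=> sT; have [_ _ _ _] := flow_is_solution phi_C1 x; apply.
  exact: (before_exit_time sT Tx).1.
have soly s : 0 <= s <= T -> is_derive s (1 : R) (fun t => flow phi t y) (phi (flow phi s y)).
  move=> sT; have [_ _ _ _] := flow_is_solution phi_C1 y; apply.
  exact: (before_exit_time sT Ty).1.
pose z s := flow phi s x - flow phi s y.
have dz s : 0 <= s <= T -> is_derive s (1 : R) z (phi (flow phi s x) - phi (flow phi s y)).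
  by move=> sT; exact: is_deriveB (solx s sT) (soly s sT).
have z0 : z 0 = x - y.
  have [_ _ _ fx _] := flow_is_solution phi_C1 x.
  by have [_ _ _ fy _] := flow_is_solution phi_C1 y; rewrite /z fx fy.
rewrite -/(z T) -z0 !NE -EFinM lee_fin leNgt; apply/negP => NT.
have {}NT : N (z 0) < expR (- b * T) * N (z T).
  by rewrite mulNr expRN ltr_pdivlMl ?expR_gt0.
(* Small enough for [K T > K 0] below, so that the maximum of [K] is not at 0. *)
pose eps := (expR (- b * T) * N (z T) - N (z 0)) / (T + 1).
have T1 : 0 < T + 1 by lra.
have eps0 : 0 < eps by rewrite divr_gt0 // subr_gt0.
have epsT : eps * (T + 1) = expR (- b * T) * N (z T) - N (z 0).
  by rewrite /eps divfK // gt_eqF.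
pose K s := expR (- b * s) * N (z s) - eps * s.
have K_cont : {within `[0, T], continuous K}.
  have zc : {within `[0, T], continuous z}.
    apply: derivable_within_continuous => s; rewrite in_itv => /dz H.
    exact: (@ex_derive _ _ _ _ _ _ _ H).
  move=> s; apply: (@cvgB _ _ _ (nbhs s) _ (fun s => expR (- b * s) * N (z s)) (fun s => eps * s)).
    apply: (@cvgM _ _ (nbhs s)).
      apply: continuous_subspaceT => {}s; apply: differentiable_continuous.
      apply/derivable1_diffP;
        exact: (@ex_derive _ _ _ _ _ _ _ (is_derive_expRM _ _)).
    exact: (continuous_comp (zc s) (@N_cont _)).
  apply: continuous_subspaceT => {}s; exact: mulrl_continuous.
have [c] := EVT_max T0 K_cont; rewrite in_itv /= => cT cmax.
have Kc : N (z 0) < K c.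
  have : K T <= K c by apply: cmax; rewrite in_itv /= T0 lexx.
  by rewrite /K; lra.
have c0 : 0 < c.
  have /andP[+ _] := cT; rewrite le_eqVlt => /orP[/eqP c0|//].
  move: Kc; rewrite /K -c0 !mulr0 expR0 mul1r subr0. by rewrite !ltxx.
have [pi [nu [piS nuS zc]]] := hopf_attained C_closed C_cone C_pointed e_int (z c) e0.
pose l : 'Hom(X, R^o) := pi - nu.
have lE w : l w = pi w - nu w :> R by rewrite /l add_lfunE opp_lfunE.
have lc : l (z c) = N (z c) :> R by move: (zc); rewrite NE lE => -[].
pose dphi := phi (flow phi c x) - phi (flow phi c y).
have l_dphi : l dphi <= b * l (z c) :> R.
  have Uxc := (before_exit_time cT Tx).2; have Uyc := (before_exit_time cT Ty).2.
  have [s s01] := mean_value l (flow phi c y) (z c).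
  have -> : flow phi c y + z c = flow phi c x by rewrite /z subrKC.
  have -> : l (phi (flow phi c x)) - l (phi (flow phi c y)) = l dphi :> R.
    by rewrite /dphi [RHS]linearB.
  move=> ->; rewrite !lE.
  apply: (hopf_h_maximizer C_closed C_cone C_pointed e_int (diff_unit0 _) _ piS nuS zc).
  by apply: hb; exact: U_segment.
have df : is_derive c (1 : R) (fun s => expR (- b * s) * l (z s) - eps * s : R)
    (expR (- b * c) * (l dphi - b * l (z c)) - eps).
  have dl := is_derive_functional l (dz c cT).
  have H := is_deriveB (is_deriveM (is_derive_expRM (- b) c) dl)
    (is_deriveZ eps (is_derive_id c (1 : R))).
  apply: (is_derive_eq H); rewrite -?[_ *: _]/(_ * _ : R) /= -/dphi; ring.
suff : 0 <= expR (- b * c) * (l dphi - b * l (z c)) - eps.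
  have : expR (- b * c) * (l dphi - b * l (z c)) <= 0.
    by rewrite pmulr_rle0 ?expR_gt0 // subr_le0.
  lra.
(* Near [c] on the left, the differentiable function is below [K], and they
   agree at [c]. *)
apply: (derive_left_max df); near=> h.
have hc : 0 <= h + c <= T.
  have h0 : h < 0 by near: h; exact: nbhs_left_lt.
  have hc : - c < h by near: h; apply: nbhs_left_gt; rewrite oppr_lt0.
  by have /andP[_ cT'] := cT; apply/andP; split; lra.
apply: (@le_trans _ _ (K (h + c))).
  rewrite /K lerD2r ler_pM2l ?expR_gt0 // lE; exact: N_ge.
by rewrite lc; apply: cmax; rewrite in_itv.
Unshelve. all: by end_near. Qed.

End ContractionRate.

Theorem theorem1p2 (R : realType) (X : finDimNormedModType R)
  (C : set X) (C_closed : closed C) (C_cone : convex_cone C)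
  (C_pointed : pointed_cone C) (e : X) (e_int : interior C e)
  (phi : X -> X) (phi_C1 : continuously_differentiable phi)
  (phi_inv : forall (lambda : R) (x : X), phi (x + lambda *: e) = phi x)
  (U : set X) (U_convex : convex_set (U : set (convex_lmodType X)))
  (U_open : open U) :
  contraction_rate phi C e U = ereal_sup [set hopf_h C e ('d phi x) | x in U].
Proof.
apply/eqP; rewrite eq_le; apply/andP; split; last first.
  apply: ge_ereal_sup => _ [x Ux <-]; apply: le_ereal_inf_tmp => _ [b /= Hb <-].
  exact: contraction_rate_ge Hb x Ux.
set S := ereal_sup _.
(* The infimum runs over real exponents, so an infinite supremum is treated
   apart. *)
have rate_le (b : R) : (S <= b%:E)%E -> (contraction_rate phi C e U <= b%:E)%E.
  move=> Sb; apply: ereal_inf_lbound; exists b => //=.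
  apply: contraction_rate_le => // x Ux; apply: le_trans Sb.
  by apply: ereal_sup_ubound; exists x.
case: S rate_le => [s rate_le|_|rate_le]; [exact: rate_le|exact: leey|].
have {}rate_le b : (contraction_rate phi C e U <= b%:E)%E.
  by apply: rate_le; exact: leNye.
case: (contraction_rate phi C e U) rate_le => [r|/(_ 0)|] // /(_ (r - 1)).
by rewrite lee_fin lerBrDr gerDl ler10.
Qed.
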